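(* Let $H$ be a complex Hilbert space with $\dim H\ge 3$ (possibly infinite-dimensional) and let $k$ be an integer with $0<k<\dim H$ (any integer $k>0$ if $H$ is infinite-dimensional). (a) If $\dim H\neq 2k$ (in particular, if $H$ is infinite-dimensional), then every automorphism of the graph $\Gamma^{\perp}_k(H)$ is induced by a unitary or anti-unitary operator on $H$; that is, for every automorphism $f$ of $\Gamma^{\perp}_k(H)$ there is a unitary or anti-unitary operator $U$ on $H$ such that $f(X)=U(X)$ for every $k$-dimensional subspace $X\subset H$. (b) If $\dim H=2k\ge 6$, then for every automorphism $f$ of $\Gamma^{\perp}_k(H)$ there is a unitary or anti-unitary operator $U$ on $H$ such that either $f(X)=U(X)$ for every $k$-dimensional subspace $X\subset H$, or $f(X)=U(X)^{\perp}$ for every $k$-dimensional subspace $X\subset H$.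
   Context: Let $\mathcal{G}_k(H)$ be the set of all $k$-dimensional subspaces of $H$. Two elements of $\mathcal{G}_k(H)$ are adjacent if their intersection is $(k-1)$-dimensional (equivalently, their sum is $(k+1)$-dimensional). Two closed subspaces $X,Y\subset H$ are compatible if there is an orthonormal basis of $H$ such that $X$ and $Y$ are both spanned by subsets of this basis (equivalently, the orthogonal projections $P_X,P_Y$ commute). Two elements of $\mathcal{G}_k(H)$ are ortho-adjacent if they are adjacent and compatible. The ortho-Grassmann graph $\Gamma^{\perp}_k(H)$ is the simple graph with vertex set $\mathcal{G}_k(H)$ in which two vertices are joined by an edge if and only if they are ortho-adjacent. An automorphism of a graph is a bijection of the vertex set preserving edges in both directions. A unitary operator is an invertible linear operator on $H$ preserving the inner product. An anti-unitary operator is an invertible conjugate-linear operator $U$ on $H$ with $\langle U(x),U(y)\rangle=\overline{\langle x,y\rangle}$ for all $x,y\in H$. *)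

(* Defs.v *)
From HB Require Import structures.
From mathcomp Require Import all_boot all_order all_algebra complex.
From mathcomp Require Import all_classical all_reals.
From mathcomp Require Import topology normedtype.

Set Implicit Arguments.
Unset Strict Implicit.
Unset Printing Implicit Defensive.
Import Order.TTheory GRing.Theory Num.Theory Num.Def.
Import numFieldNormedType.Exports.
Local Open Scope classical_set_scope.
Local Open Scope ring_scope.

(* A complex Hilbert space is a complete normed module [H] over [R[i]] with a
   positive definite form [dot] such that [dot x x = `|x| ^+ 2].  The form is
   linear in its first argument and conjugate-linear in the second. *)

Section LinearAlgebra.
Context {R : realType} {H : completeNormedModType R[i]}.
Implicit Types (X B : set H) (n : nat).

Definition linear_subspace : set (set H) :=
  [set X : set H | GRing.submod_closed (fun x : H => x \in X)].

Definition linspan B : set H := smallest linear_subspace B.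

Definition lin_indep n (e : 'I_n -> H) : Prop :=
  forall c : 'I_n -> R[i], \sum_i c i *: e i = 0 -> forall i, c i = 0.

Definition has_dim X n : Prop :=
  exists2 e : 'I_n -> H, lin_indep e & X = linspan (range e).

(* Holds for every [n] when [X] is an infinite-dimensional subspace. *)
Definition dim_ge X n : Prop :=
  exists2 e : 'I_n -> H, lin_indep e & range e `<=` X.

Definition grassmann n : set (set H) :=
  [set X : set H | linear_subspace X /\ has_dim X n].

(* The intersection is required to have dimension [k - 1]; meant for [0 < k]. *)
Definition adjacent k X Y : Prop :=
  [/\ grassmann k X, grassmann k Y & grassmann k.-1 (X `&` Y)].

End LinearAlgebra.

Section Hilbert.
Context {R : realType} {H : completeNormedModType R[i]}.
Variable dot : {dot H for conjC}.
Implicit Types (X Y B : set H) (k : nat).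

Definition orthocompl X : set H := [set y | forall x, X x -> dot x y = 0].

Definition orthonormal_set B : Prop :=
  {in B &, forall u v, dot u v = (u == v)%:R}.

(* Orthonormal bases are Hilbert bases: finite linear combinations are only
   required to be dense, and [B] may be uncountable. *)
Definition orthonormal_basis B : Prop :=
  orthonormal_set B /\ closure (linspan B) = setT.

Definition compatible X Y : Prop :=
  exists2 B, orthonormal_basis B &
    exists S T, [/\ S `<=` B, T `<=` B,
      X = closure (linspan S) & Y = closure (linspan T)].

Definition ortho_adjacent k X Y : Prop := adjacent k X Y /\ compatible X Y.

(* Only the restriction of [f] to the k-dimensional subspaces matters. *)
Definition ortho_grassmann_automorphism k (f : set H -> set H) : Prop :=
  set_bij (grassmann k) (grassmann k) f /\
  forall X Y, grassmann k X -> grassmann k Y ->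
    (ortho_adjacent k X Y <-> ortho_adjacent k (f X) (f Y)).

Definition unitary (U : H -> H) : Prop :=
  [/\ bijective U, linear U & forall x y, dot (U x) (U y) = dot x y].

Definition antiunitary (U : H -> H) : Prop :=
  [/\ bijective U, GRing.linear_for (conjC \; *:%R) U &
      forall x y, dot (U x) (U y) = conjC (dot x y)].

End Hilbert.

(* Main.v *)
Require Import Defs.
From HB Require Import structures.
From mathcomp Require Import all_boot all_order all_algebra complex.
From mathcomp Require Import all_classical all_reals.
From mathcomp Require Import topology normedtype.
From mathcomp Require Import lra zify.

Set Implicit Arguments.
Unset Strict Implicit.
Unset Printing Implicit Defensive.
Import Order.TTheory GRing.Theory Num.Theory Num.Def.
Import numFieldNormedType.Exports.
Local Open Scope classical_set_scope.
Local Open Scope ring_scope.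

(* Two vertices are ortho-adjacent when they are [Z + Cx] and [Z + Cy] with [x]
   and [y] orthogonal to each other and to a (k-1)-dimensional [Z].  A triangle
   is then a "star" (its vertices share a (k-1)-dimensional subspace) or a "top"
   (they lie in a (k+1)-dimensional one).  The type is not graph-invariant, but
   "two triangles with a common edge have the same type" is.  Hence, when
   dim H >= k + 3, an automorphism maps all star triangles over a given [Z] to
   stars, or all of them to tops.  If dim H > 2k the second alternative is
   excluded by the size of cliques; if dim H = 2k the alternative is the same for
   every [Z] by connectedness, and composing with orthocomplementation reduces to
   the first one.  Automorphisms preserving stars induce automorphisms for k - 1,
   down to k = 1, where they are bijections of lines preserving orthogonality.
   For a unit vector [e], such a bijection maps the line of [e + v], with [v]
   orthogonal to [e], to that of [e' + T v], where [<v,w> = -1] iff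
   [<T v,T w> = -1]; this forces [T] to be additive and semilinear for an
   automorphism of the complex field commuting with conjugation, which preserves
   the order of the reals and so is the identity or the conjugation.  The case
   dim H < 2k follows by taking orthogonal complements. *)

(** * Subspaces by orthogonal dimension *)

(** The bound dim H >= k + 3 comes from linking two star triangles over [Z]: the links need vectors
    orthogonal to [Z] and to three further vectors, and (k - 1) + 3 + 1 = k + 3. If dim H = 2k it
    reads k >= 3, which is the hypothesis 2k >= 6; if dim H > 2k it holds as soon as k >= 2, and k =
    1 is the case of lines. In a 4-clique all triangles have the same type. Two star triangles on a
    common edge form a 4-clique only if their remaining directions are orthogonal; the other pairs
    are the obstacle, and for them [star_edge] finds a further vertex. If dim H = 2k, one descent
    leads to (k - 1)-dimensional subspaces, and dim H > 2(k - 1), so the case already settled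
    applies. Only the products 0 and -1 can be read off from orthogonality of lines, the latter
    because <e + v, e + w> = 1 + <v,w>; everything about [T] is extracted from these two values.
    Completeness of H enters through compatibility, which asks for an orthonormal basis of all of
    H. *)

Section Dot.
Context {C : numClosedFieldType} {H : lmodType C}.
Variable dot : {dot H for conjC}.
Implicit Types (a b c : C) (u v w x y z : H).

Lemma dot0l x : dot 0 x = 0. Proof. exact: linear0l. Qed.
Lemma dot0r x : dot x 0 = 0. Proof. exact: linear0r. Qed.
Lemma dotDl x y z : dot (x + y) z = dot x z + dot y z.
Proof. exact: linearDl. Qed.
Lemma dotDr x y z : dot z (x + y) = dot z x + dot z y.
Proof. exact: linearDr. Qed.
Lemma dotNl x y : dot (- x) y = - dot x y. Proof. exact: linearNl. Qed.
Lemma dotNr x y : dot x (- y) = - dot x y. Proof. exact: linearNr. Qed.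
Lemma dotZl a x y : dot (a *: x) y = a * dot x y.
Proof. exact: linearZl_LR. Qed.
Lemma dotZr a x y : dot x (a *: y) = conjC a * dot x y.
Proof. exact: linearZr_LR. Qed.
Lemma dotBl x y z : dot (x - y) z = dot x z - dot y z.
Proof. by rewrite dotDl dotNl. Qed.
Lemma dotBr x y z : dot z (x - y) = dot z x - dot z y.
Proof. by rewrite dotDr dotNr. Qed.
Lemma dotC x y : dot x y = conjC (dot y x).
Proof. by rewrite hermC expr0 mul1r. Qed.
Lemma dot_eq0 x : (dot x x == 0) = (x == 0).
Proof. exact: dnorm_eq0. Qed.
Lemma dot_neq0 x : x != 0 -> dot x x != 0. Proof. by rewrite dot_eq0. Qed.
Lemma dotxx0 x : dot x x = 0 -> x = 0.
Proof. by move/eqP; rewrite dot_eq0 => /eqP. Qed.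
Lemma dot_sym0 x y : dot x y = 0 -> dot y x = 0.
Proof. by move=> xy; rewrite dotC xy conjC0. Qed.

Definition dot_simp :=
  (dotDl, dotDr, dotNl, dotNr, dotZl, dotZr, dot0l, dot0r).

End Dot.

Section Subspaces.
Context {C : numClosedFieldType} {H : lmodType C}.
Variable dot : {dot H for conjC}.
Implicit Types (a b c : C) (u v w x y z : H) (X Y Z : set H) (n m j : nat).

Definition subspace X := X 0 /\ forall a x y, X x -> X y -> X (a *: x + y).

Section Closure.
Variable X : set H.
Hypothesis sX : subspace X.
Lemma sub0 : X 0. Proof. by case: sX. Qed.
Lemma subZ a x : X x -> X (a *: x).
Proof. by case: sX => X0 XL Xx; rewrite -[_ *: _]addr0; apply: XL. Qed.
Lemma subD x y : X x -> X y -> X (x + y).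
Proof. by case: sX => X0 XL Xx Xy; rewrite -[x]scale1r; apply: XL. Qed.
Lemma subN x : X x -> X (- x).
Proof. by move=> Xx; rewrite -scaleN1r; apply: subZ. Qed.
Lemma subB x y : X x -> X y -> X (x - y).
Proof. by move=> Xx Xy; apply/subD => //; apply: subN. Qed.
Lemma sub_addr x y : X x -> X (y + x) -> X y.
Proof. by move=> Xx Xxy; rewrite -(addrK x y); apply: subB. Qed.
Lemma subZK a x : a != 0 -> X (a *: x) -> X x.
Proof. by move=> a0 /(subZ a^-1); rewrite scalerA mulVf // scale1r. Qed.
End Closure.

Definition perp X : set H := [set y | forall x, X x -> dot x y = 0].

Lemma sub_perp X : subspace (perp X).
Proof.
split=> [x _|a x y ox oy z Xz]; first exact: dot0r.
by rewrite !dot_simp ox // oy // mulr0 addr0.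
Qed.

Lemma perpW X Y y : X `<=` Y -> perp Y y -> perp X y.
Proof. by move=> XY oy x Xx; apply/oy/XY. Qed.

Lemma perp_self X x : X x -> perp X x -> x = 0.
Proof. by move=> Xx ox; apply: (@dotxx0 _ _ dot); apply: ox. Qed.

Lemma sub_perp_perp X : X `<=` perp (perp X).
Proof. by move=> x Xx y oy; apply/dot_sym0/oy. Qed.

Definition addl X x : set H := [set w | exists z a, X z /\ w = z + a *: x].
Local Notation "X <+> x" := (addl X x) (at level 50, left associativity).

Lemma addlW X x : X `<=` X <+> x.
Proof. by move=> z Xz; exists z, 0; rewrite scale0r addr0. Qed.

Lemma addl_id X x : subspace X -> (X <+> x) x.
Proof. by move=> sX; exists 0, 1; rewrite scale1r add0r; split=> //; apply: sub0. Qed.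

Lemma sub_addl X x : subspace X -> subspace (X <+> x).
Proof.
move=> sX; split; first by apply: addlW; apply: sub0.
move=> a _ _ [z [b [Xz ->]]] [t [c [Xt ->]]].
exists (a *: z + t), (a * b + c); split; first by apply: (subD sX) => //; apply: subZ.
by rewrite scalerDr scalerDl scalerA addrACA.
Qed.

Lemma addl_least X x Y : subspace Y -> X `<=` Y -> Y x -> X <+> x `<=` Y.
Proof.
by move=> sY XY Yx _ [z [a [Xz ->]]]; apply: subD; [| exact: XY | exact: subZ].
Qed.

Lemma addlS X Y x : X `<=` Y -> X <+> x `<=` Y <+> x.
Proof. by move=> XY _ [z [a [Xz ->]]]; exists z, a; split=> //; apply: XY. Qed.

Lemma addlAC X x y : X <+> x <+> y = X <+> y <+> x.
Proof.
have h u v : X <+> u <+> v `<=` X <+> v <+> u.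
  move=> _ [_ [a [[z [b [Xz ->]]] ->]]]; exists (z + a *: v), b.
  by rewrite addrAC; split=> //; exists z, a.
by apply/seteqP; split.
Qed.

Lemma addl_scale X x a : a != 0 -> X <+> (a *: x) = X <+> x.
Proof.
move=> a0; apply/seteqP; split=> _ [z [b [Xz ->]]]; exists z.
  by exists (b * a); rewrite scalerA.
by exists (b / a); rewrite scalerA divfK.
Qed.

Lemma perp_addl X x y : perp X y -> dot x y = 0 -> perp (X <+> x) y.
Proof.
move=> oy xy _ [z [a [Xz ->]]].
by rewrite !dot_simp oy // xy mulr0 addr0.
Qed.

Definition nperp X x := x != 0 /\ perp X x.

Lemma nperp_n0 X x : nperp X x -> x != 0. Proof. by case. Qed.
Lemma nperp_orth X x w : nperp X x -> X w -> dot w x = 0.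
Proof. by case=> _; apply. Qed.
Lemma nperp_orthl X x w : nperp X x -> X w -> dot x w = 0.
Proof. by move=> px Xw; apply/dot_sym0/(nperp_orth px). Qed.

Lemma nperpW X Y x : X `<=` Y -> nperp Y x -> nperp X x.
Proof. by move=> XY [x0 ox]; split=> //; apply: perpW ox. Qed.

Lemma nperp_addl X x y : nperp X y -> dot x y = 0 -> nperp (X <+> x) y.
Proof. by move=> [y0 oy] xy; split=> //; apply: perp_addl. Qed.

Lemma nperp_base X x y : nperp (X <+> x) y -> nperp X y.
Proof. exact/nperpW/addlW. Qed.

Lemma nperp_dot X x y : subspace X -> nperp (X <+> x) y -> dot x y = 0.
Proof. by move=> sX [_]; apply; apply: addl_id. Qed.

Lemma nperp_swap X x y : subspace X -> nperp X x -> nperp (X <+> x) y -> nperp (X <+> y) x.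
Proof.
by move=> sX px py; apply: nperp_addl => //; apply/dot_sym0/nperp_dot/py.
Qed.

Lemma addl_line X x w : subspace X -> perp X x -> (X <+> x) w -> perp X w ->
  exists a, w = a *: x.
Proof.
move=> sX ox [z [a [Xz ->]]] ow; exists a.
suff -> : z = 0 by rewrite add0r.
apply: perp_self (Xz) _; apply: sub_addr ow; first exact: sub_perp.
by apply: subZ ox; apply: sub_perp.
Qed.

Lemma addl_perp X x w : subspace X -> nperp X x -> (X <+> x) w -> dot x w = 0 -> X w.
Proof.
move=> sX [x0 ox] [z [a [Xz ->]]].
rewrite !dot_simp [dot x z]dot_sym0 ?add0r; last exact: ox.
move/eqP; rewrite mulf_eq0 (negPf (dot_neq0 _ x0)) orbF conjC_eq0 => /eqP ->.
by rewrite scale0r addr0.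
Qed.

Lemma addl_inter X x y w : subspace X -> nperp X x -> nperp (X <+> x) y ->
  (X <+> x) w -> (X <+> y) w -> X w.
Proof.
move=> sX px py Xxw Xyw; apply: addl_perp (Xyw) _ => //; first exact: nperp_base py.
by apply/dot_sym0; case: py => _; apply.
Qed.

Definition hyp X x : set H := [set w | X w /\ dot x w = 0].

Lemma nperp_hyp X x : x != 0 -> nperp (hyp X x) x.
Proof. by move=> x0; split=> // w [_]; apply: dot_sym0. Qed.

Lemma dot_proj x v : x != 0 -> dot x (v - (dot v x / dot x x) *: x) = 0.
Proof.
move=> x0; rewrite !dot_simp rmorphM /= fmorphV /= -!dotC divfK ?subrr //.
exact: dot_neq0.
Qed.

Lemma hyp_addlE X x : subspace X -> X x -> x != 0 -> hyp X x <+> x = X.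
Proof.
move=> sX Xx x0; apply/seteqP; split.
  by apply: addl_least => // w [].
move=> w Xw; exists (w - (dot w x / dot x x) *: x), (dot w x / dot x x).
by rewrite subrK; split=> //; split; [apply: subB => //; apply: subZ|apply: dot_proj].
Qed.

Lemma hyp_addl X x : subspace X -> nperp X x -> hyp (X <+> x) x = X.
Proof.
move=> sX px; apply/seteqP; split=> [w [Xw xw]|w Xw]; first exact: addl_perp xw.
by split; [apply: addlW|apply/dot_sym0; case: px => _; apply].
Qed.

(** An orthogonal basis, added one vector at a time: every induction step comes with a direction
    orthogonal to what precedes. [has_dimE] identifies this with the dimension by linearly
    independent families. *)
Inductive odim : nat -> set H -> Prop :=
| odim0 : odim 0 [set 0]
| odimS n Z x : odim n Z -> nperp Z x -> odim n.+1 (Z <+> x).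

Lemma odim_sub n X : odim n X -> subspace X.
Proof.
elim=> [|{}n Z x _ sZ _]; last exact: sub_addl.
by split=> // a x y -> ->; rewrite scaler0 addr0.
Qed.

Lemma odim0_inv X : odim 0 X -> X = [set 0].
Proof. by move E : 0%N => n h; case: h E. Qed.

Lemma odimS_inv n X : odim n.+1 X -> exists Z x, [/\ odim n Z, nperp Z x & X = Z <+> x].
Proof. by move E : n.+1 => m h; case: h E => // j Z x oZ px [->]; exists Z, x. Qed.

(** An exchange lemma: any nonzero vector of [X] can serve as the last vector of an orthogonal
    basis. That the dimension is well defined rests on it. *)
Lemma odim_hyp n X x : odim n.+1 X -> X x -> x != 0 -> odim n (hyp X x).
Proof.
elim: n X x => [|n IHn] X x /odimS_inv[Z [z [oZ pz ->]]] [z0 [a [Zz0 xE]]] x0.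
  move: (odim0_inv oZ) => ZE.
  have {}xE : x = a *: z by move: Zz0; rewrite xE ZE => ->; rewrite add0r.
  have a0 : a != 0 by apply: contraNneq x0 => a0; rewrite xE a0 scale0r.
  rewrite -(addl_scale _ _ a0) -xE hyp_addl //; first exact: odim_sub oZ.
  by split=> // y; rewrite ZE => ->; apply: dot0l.
have sZ := odim_sub oZ.
have [z0E|z00] := eqVneq z0 0.
  have {}xE : x = a *: z by rewrite xE z0E add0r.
  have a0 : a != 0 by apply: contraNneq x0 => a0; rewrite xE a0 scale0r.
  rewrite -(addl_scale _ _ a0) -xE hyp_addl //.
  split=> // y Zy; rewrite xE dotZr; case: pz => _ -> //; exact: mulr0.
have oZ1 := IHn _ _ oZ Zz0 z00; set Z1 := hyp Z z0 in oZ1.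
have ZE : Z = Z1 <+> z0 by rewrite hyp_addlE.
have sZ1 := odim_sub oZ1.
(* In the plane of [z0] and [z], which is orthogonal to [Z1], the orthogonal basis [z0], [z] is
   replaced by [y], [x]. *)
pose c := dot z x / dot x x; pose y := z - c *: x.
have xy : dot x y = 0 by apply: dot_proj.
have zz0 : dot z0 z = 0 by apply: nperp_orth pz _.
have p1x : perp Z1 x.
  by move=> w [Zw z0w]; rewrite xE !dot_simp (dot_sym0 z0w) (nperp_orth pz) // mulr0 addr0.
have p1y : perp Z1 y.
  apply: (subB (sub_perp _)); last by apply: (subZ (sub_perp _)).
  by move=> w [Zw _]; apply: nperp_orth pz Zw.
have y0 : y != 0.
  apply/negP => /eqP/(canRL (subrK _)); rewrite add0r => zE.
  have z0x : dot z0 x = dot z0 z0 by rewrite xE !dot_simp zz0 mulr0 addr0.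
  move/eqP: (zz0); rewrite zE dotZr z0x mulf_eq0 (negPf (dot_neq0 _ z00)) orbF.
  rewrite conjC_eq0 => /eqP c0; move: (proj1 pz).
  by rewrite zE c0 scale0r eqxx.
have sZ1y := sub_addl y sZ1.
have XE : Z <+> z = Z1 <+> y <+> x.
  have sR := sub_addl x sZ1y; have Rx := addl_id x sZ1y.
  have Ry : (Z1 <+> y <+> x) y by apply/addlW/addl_id.
  have Rz : (Z1 <+> y <+> x) z.
    by rewrite -[z](subrK (c *: x)); apply: subD => //; apply: subZ.
  have Lx : (Z <+> z) x by exists z0, a.
  have sL := sub_addl z sZ; have Lz := addl_id z sZ.
  apply/seteqP; split; apply: addl_least => //.
    rewrite ZE; apply: addl_least => //; first by move=> w Zw; apply/addlW/addlW.
    have -> : z0 = x - a *: z by rewrite xE addrK.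
    by apply: subB => //; apply: subZ.
  apply: addl_least => //; first by move=> w [Zw _]; apply: addlW.
  by apply: subB => //; apply: subZ.
rewrite XE hyp_addl //; first exact: odimS.
by split=> //; apply: perp_addl => //; apply: dot_sym0.
Qed.

(** The last basis vector [x] of [X] is split off on both sides: [Z] lies in the complement of [x]
    in [Y], whose dimension [odim_hyp] gives. *)
Lemma odim_uniq n m X Y : odim n X -> odim m Y -> X `<=` Y ->
  (n <= m)%N /\ (n = m -> X = Y).
Proof.
move=> oX; elim: oX m Y => {n X} [|n Z x oZ IHn px] [|m] Y oY XY.
- by split=> // _; rewrite (odim0_inv oY).
- by split.
- move: (proj1 px); suff -> : x = 0 by rewrite eqxx.
  by have := XY _ (addl_id x (odim_sub oZ)); rewrite (odim0_inv oY).
have sZ := odim_sub oZ; have sY := odim_sub oY.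
have Yx : Y x by apply/XY/addl_id.
have oh := odim_hyp oY Yx (proj1 px).
have [|nm E] := IHn _ _ oh.
  move=> w Zw; split; first by apply/XY/addlW.
  by apply/dot_sym0; case: px => _; apply.
by split=> // -[/E ->]; rewrite hyp_addlE // (proj1 px).
Qed.

Lemma odim_sameE n X Y : odim n X -> odim n Y -> X `<=` Y -> X = Y.
Proof. by move=> oX oY /(odim_uniq oX oY)[_]; apply. Qed.

Lemma odim_le n m X Y : odim n X -> odim m Y -> X `<=` Y -> (n <= m)%N.
Proof. by move=> oX oY /(odim_uniq oX oY)[]. Qed.

Lemma odim_dim n m X : odim n X -> odim m X -> n = m.
Proof.
move=> oX oY; apply/eqP.
by rewrite eqn_leq (odim_le oX oY) ?(odim_le oY oX).
Qed.

Lemma odim_projE n X v : odim n X -> exists2 p, X p & perp X (v - p).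
Proof.
elim=> [|{}n Z x oZ [p Zp op] px].
  by exists 0 => // _ ->; apply: dot0l.
have sZ := odim_sub oZ.
pose c := dot v x / dot x x; exists (p + c *: x); first by exists p, c.
apply: perp_addl.
  rewrite opprD addrA; apply: subB op _; first exact: sub_perp.
  by apply: (subZ (sub_perp _)); apply: proj2 px.
rewrite opprD addrCA addrC dotDr dotNr [dot x p]dot_sym0 ?(proj2 px) //.
by rewrite oppr0 addr0 dot_proj // (proj1 px).
Qed.

Lemma perp_perpE n X : odim n X -> perp (perp X) = X.
Proof.
move=> oX; apply/seteqP; split; last exact: sub_perp_perp.
move=> v ov; have [p Xp op] := odim_projE v oX.
rewrite -[v](subrK p); suff -> : v - p = 0 by rewrite add0r.
apply: perp_self op _; apply: (subB (sub_perp _)) => //.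
by apply: sub_perp_perp.
Qed.

Lemma odim_complete n X Y : odim n X -> odim n.+1 Y -> X `<=` Y ->
  exists2 x, nperp X x & Y = X <+> x.
Proof.
move=> oX oY XY.
have [v [Yv Xv]] : exists v, Y v /\ ~ X v.
  apply: contrapT => h; suff YX : Y `<=` X.
    by have := odim_le oY oX YX; rewrite ltnn.
  by move=> v Yv; apply: contrapT => Xv; apply: h; exists v.
have [p Xp op] := odim_projE v oX.
have pv : nperp X (v - p).
  split=> //; apply/eqP => /(canRL (subrK _)); rewrite add0r => vp.
  by apply: Xv; rewrite vp.
exists (v - p) => //; symmetry; apply: (odim_sameE (odimS oX pv) oY).
have sY := odim_sub oY.
by apply: addl_least => //; apply: subB => //; apply: XY.
Qed.

(* The dimension is at least [n]. *)
Definition room n := forall m X, odim m X -> (m < n)%N -> exists x, nperp X x.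

(* Ortho-adjacency of (j+1)-dimensional subspaces; [j] is the dimension of the
   intersection. *)
Definition oadj j X Y := exists Z x y,
  [/\ odim j Z, nperp Z x, nperp (Z <+> x) y, X = Z <+> x & Y = Z <+> y].

Lemma oadj_intro j Z x y : odim j Z -> nperp Z x -> nperp (Z <+> x) y ->
  oadj j (Z <+> x) (Z <+> y).
Proof. by move=> oZ px py; exists Z, x, y. Qed.

Lemma oadj_sym j X Y : oadj j X Y -> oadj j Y X.
Proof.
move=> [Z [x [y [oZ px py -> ->]]]]; exists Z, y, x.
by split=> //; [apply: nperp_base py|apply: nperp_swap => //; apply: odim_sub oZ].
Qed.

Lemma oadj_od j X Y : oadj j X Y -> odim j.+1 X.
Proof. by move=> [Z [x [y [oZ px py -> _]]]]; apply: odimS. Qed.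

Lemma oadj_neq j X Y : oadj j X Y -> X <> Y.
Proof.
move=> [Z [x [y [oZ px py -> ->]]]] E; have sZ := odim_sub oZ.
have : (Z <+> x) y by rewrite E; apply: addl_id.
by move/perp_self/(_ (proj2 py)) => y0; move: (proj1 py); rewrite y0 eqxx.
Qed.

Lemma oadj_inter j Z x Y : odim j Z -> nperp Z x -> oadj j (Z <+> x) Y -> Z `<=` Y ->
  exists2 y, nperp (Z <+> x) y & Y = Z <+> y.
Proof.
move=> oZ px [Z0 [x0 [y0 [oZ0 px0 py0 E0 ->]]]] ZY.
suff ZE : Z = Z0 by rewrite E0 ZE; exists y0.
apply: (odim_sameE oZ oZ0) => z Zz; apply: (addl_inter (odim_sub oZ0) px0 py0).
- by rewrite -E0; apply: addlW.
- exact: ZY.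
Qed.

(** [Z <+> y] is also [Z <+> y0] with [y0] orthogonal to [Z <+> x], and its vectors orthogonal to
    [Z] form a single line. *)
Lemma oadj_star j Z x y : odim j Z -> nperp Z x -> nperp Z y ->
  oadj j (Z <+> x) (Z <+> y) -> nperp (Z <+> x) y.
Proof.
move=> oZ px py /(oadj_inter oZ px)[|y0 py0 E]; first exact: addlW.
have sZ := odim_sub oZ.
have [|a yE] := addl_line sZ (proj2 (nperp_base py0)) (w := y) _ (proj2 py).
  by rewrite -E; apply: addl_id.
split; first exact: proj1 py.
by rewrite yE; apply: (subZ (sub_perp _)); apply: proj2 py0.
Qed.

(** Split [x] as [r + a *: p] with [r] in [P]. Both [x] and [p] are orthogonal to [Q], so [r] is a
    multiple of [c'], hence orthogonal to [Z], hence a multiple of [x]. If [r] is 0, then [x] is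
    along [p] and [Z] lies in [P]; otherwise [x] lies in [P]. *)
Let star_or_mem j Z x y C0 : odim j Z -> nperp Z x -> nperp (Z <+> x) y ->
    oadj j (Z <+> x) C0 -> oadj j (Z <+> y) C0 ->
  Z `<=` C0 \/ exists P (c : H), [/\ odim j P, nperp (Z <+> x) c, P x & C0 = P <+> c /\
    P `<=` Z <+> x].
Proof.
move=> oZ px py [P [p [c [oP nperp_p pc XE CE]]]] [Q [q [c' [oQ pq pc' YE CE']]]].
have [[sZ sP] sQ] := (odim_sub oZ, odim_sub oP, odim_sub oQ).
have Xx : (P <+> p) x by rewrite -XE; apply: addl_id.
have pxY : nperp (Z <+> y) x by apply: nperp_swap.
have opC0 : nperp C0 p by rewrite CE; apply: nperp_swap.
case: (Xx) => r [a [Pr xE]].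
have rE : r = x - a *: p by rewrite xE addrK.
have QY : Q `<=` Z <+> y by rewrite YE; apply: addlW.
have oQr : perp Q r.
  rewrite rE; apply: (subB (sub_perp _)).
    by move=> w Qw; apply: nperp_orth pxY _; apply: QY.
  apply: (subZ (sub_perp _)) => w Qw; apply: nperp_orth opC0 _.
  by rewrite CE'; apply: addlW.
have C0r : (Q <+> c') r by rewrite -CE' CE; apply: addlW.
have [b rc'] := addl_line sQ (proj2 (nperp_base pc')) C0r oQr.
have oYr : perp (Z <+> y) r.
  by rewrite rc'; apply: (subZ (sub_perp _)); rewrite YE; case: pc'.
have oZr : perp Z r by apply: perpW oYr; apply: addlW.
have PX : P `<=` Z <+> x by rewrite XE; apply: addlW.
have [g rx] := addl_line sZ (proj2 px) (PX _ Pr) oZr.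
have [g0|g0] := eqVneq g 0; last first.
  right; exists P, c; split=> //; first by rewrite XE.
  by apply: (subZK sP g0); rewrite -rx.
left.
have {xE} xE : x = a *: p by rewrite xE rx g0 scale0r add0r.
have a0 : a != 0 by apply: contraNneq (nperp_n0 px) => a0; rewrite xE a0 scale0r.
move=> z Zz; rewrite CE; apply: addlW; apply: (addl_perp sP nperp_p).
  by rewrite -XE; apply: addlW.
have := nperp_orthl px Zz; rewrite xE dotZl => /eqP.
by rewrite mulf_eq0 (negPf a0) => /eqP.
Qed.

(* A vertex adjacent to both ends of the edge [Z <+> x -- Z <+> y] closes it
   to a triangle of one of two types: all three vertices contain [Z] ("star"),
   or all three lie in [Z <+> x <+> y] ("top"). *)
Lemma triangle_cases j Z x y C0 : odim j Z -> nperp Z x -> nperp (Z <+> x) y ->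
    oadj j (Z <+> x) C0 -> oadj j (Z <+> y) C0 ->
  (exists2 c : H, nperp (Z <+> x <+> y) c & C0 = Z <+> c) \/
  (exists i B z, [/\ j = i.+1, odim i B, nperp B z, Z = B <+> z &
     C0 = B <+> x <+> y]).
Proof.
move=> oZ px py XC YC; have sZ := odim_sub oZ.
have [ZC|[P [c [oP pc Px [CE PX]]]]] := star_or_mem oZ px py XC YC.
  left; have [c pc E] := oadj_inter oZ px XC ZC.
  exists c => //; apply: (nperp_addl pc); apply: (nperp_dot sZ).
  by apply: (oadj_star oZ (nperp_base py) (nperp_base pc)); rewrite -E.
have [ZC|[Q [c' [oQ pc' Qy [CE' _]]]]] :=
    star_or_mem oZ (nperp_base py) (nperp_swap sZ px py) YC XC.
  left; have [d pd E] := oadj_inter oZ px XC ZC.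
  exists d => //; apply: (nperp_addl pd); apply: (nperp_dot sZ).
  by apply: (oadj_star oZ (nperp_base py) (nperp_base pd)); rewrite -E.
right; have sP := odim_sub oP.
case: j => [|i] in oZ oP oQ XC YC *.
  by move: (nperp_n0 px); move: Px; rewrite (odim0_inv oP) => ->; rewrite eqxx.
(* Removing [x] from [P] leaves the part [B] of [Z] that [C0] retains, one dimension short of
   [Z]. *)
have oB := odim_hyp oP Px (nperp_n0 px); set B := hyp P x in oB.
have PE : B <+> x = P by apply: hyp_addlE => //; apply: nperp_n0 px.
have BZ : B `<=` Z by move=> b [Pb xb]; apply: (addl_perp sZ px) => //; apply: PX.
have [z pz ZE] := odim_complete oB oZ BZ.
exists i, B, z; split=> //; rewrite PE CE.
have Cy : (P <+> c) y by rewrite -CE CE'; apply: addlW.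
have [d yc] := addl_line sP (perpW PX (proj2 pc)) Cy (perpW PX (proj2 py)).
rewrite yc addl_scale //.
by apply: contraNneq (nperp_n0 py) => d0; rewrite yc d0 scale0r.
Qed.

End Subspaces.

(** * Triangles of the ortho-Grassmann graph *)

Section Triangles.
Context {C : numClosedFieldType} {H : lmodType C}.
Variable dot : {dot H for conjC}.
Implicit Types (a b c : C) (u v w x y z : H) (X Y Z : set H) (n m j : nat).
Local Notation "X <+> x" := (addl X x) (at level 50, left associativity).
Local Notation nperp := (nperp dot).
Local Notation perp := (perp dot).
Local Notation odim := (odim dot).
Local Notation oadj := (oadj dot).
Local Notation room := (room dot).

(** Used for triangles, where it separates stars from tops without naming the common subspace
    [Z]. *)
Definition star X Y D := X `&` Y `<=` D.

Lemma starC X Y D : star X Y D -> star Y X D.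
Proof. by rewrite /star setIC. Qed.

Lemma meet_addl Z x y : subspace Z -> nperp Z x -> nperp (Z <+> x) y ->
  (Z <+> x) `&` (Z <+> y) = Z.
Proof.
move=> sZ px py; apply/seteqP; split=> [w []|w Zw]; first exact: addl_inter px py.
by split; apply: addlW.
Qed.

Lemma top_not_star B x y z : subspace B -> nperp B z -> nperp (B <+> z) x ->
  nperp (B <+> z <+> x) y -> ~ (B <+> z `<=` B <+> x <+> y).
Proof.
move=> sB pz px py /(_ z (addl_id z sB)) Bz.
suff z0 : z = 0 by move: (nperp_n0 pz); rewrite z0 eqxx.
apply: (perp_self (dot := dot) Bz); apply: perp_addl; first apply: perp_addl.
- exact: proj2 pz.
- by apply: nperp_orthl px _; apply: addl_id.
- by apply: nperp_orthl py _; apply/addlW/addl_id.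
Qed.

Lemma star_swap j X Y D : oadj j X Y -> oadj j X D -> oadj j Y D ->
  star X Y D -> star X D Y.
Proof.
move=> [Z [x [y [oZ px py -> ->]]]] XD YD; have sZ := odim_sub oZ.
rewrite /star (meet_addl sZ px py) => ZD.
have [d pd ->] := oadj_inter oZ px XD ZD.
by rewrite (meet_addl sZ px pd); apply: addlW.
Qed.

(** If [X], [Y], [E] were a top, then [X], [D], [E] would be one too and [E] would contain the
    direction [d] of [D]; but [d] is orthogonal to [Z <+> x <+> y], which contains [E]. *)
Lemma star_clique j X Y D E : oadj j X Y -> oadj j X D -> oadj j Y D ->
  oadj j X E -> oadj j Y E -> oadj j D E -> star X Y D -> star X Y E.
Proof.
move=> [Z [x [y [oZ px py -> ->]]]] XD YD XE YE DE; have sZ := odim_sub oZ.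
rewrite /star (meet_addl sZ px py) => ZD.
have [[d pd DZ]|[i [B [z [_ oB pz ZE DB]]]]] := triangle_cases oZ px py XD YD; last first.
  by case: (@top_not_star B x y z) => //; rewrite -?ZE -?DB //; apply: odim_sub oB.
have pdx := nperp_base pd.
have [[e pe ->]|[i [B [z [_ oB pz ZE EB]]]]] := triangle_cases oZ px py XE YE.
  exact: addlW.
rewrite DZ in DE.
have [[e pe ->]|[i' [B' [z' [_ oB' pz' ZE' EB']]]]] := triangle_cases oZ px pdx XE DE.
  exact: addlW.
have Ed : E d by rewrite EB'; apply/addl_id/sub_addl/(odim_sub oB').
suff d0 : d = 0 by move: (nperp_n0 pd); rewrite d0 eqxx.
apply: (perp_self (dot := dot) Ed); apply: perpW (proj2 pd).
by rewrite EB; do 2!apply: addlS; rewrite ZE; apply: addlW.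
Qed.

(* [j] and [k] may differ because orthocomplementation exchanges subspaces of
   complementary dimensions. *)
Definition half_auto j k (f g : set H -> set H) :=
  [/\ forall X, odim j.+1 X -> odim k.+1 (f X),
      forall X, odim j.+1 X -> g (f X) = X &
      forall X Y, oadj j X Y -> oadj k (f X) (f Y)].

Definition auto j k f g := half_auto j k f g /\ half_auto k j g f.

Lemma auto_sym j k f g : auto j k f g -> auto k j g f.
Proof. by case. Qed.

Section StarTriangles.
Variables (j k : nat) (f g : set H -> set H) (Z : set H).
Hypotheses (fg : auto j k f g) (oZ : odim j Z).

Let sZ : subspace Z := odim_sub oZ.
Let foa X Y : oadj j X Y -> oadj k (f X) (f Y).
Proof. by case: fg => -[_ _ h] _; apply: h. Qed.

(* Otherwise the images of [x], [v], [y], [y'] are [B + z1 + x1], [B + z1 + v1],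
   [B + z1 + y1], [B + x1 + v1].  Then [T = B + x1 + y1] is adjacent to the images
   of [x], [y], [y'] but not to that of [v]; its preimage [Z + u] yields a
   direction [u'] in the span of [u] and [v] completing both triangles to
   4-cliques, and all triangles of a clique have the same type. *)
Lemma star_edge x v y y' : nperp Z x -> nperp (Z <+> x) v ->
    nperp (Z <+> x <+> v) y -> nperp (Z <+> x <+> v) y' ->
  star (f (Z <+> x)) (f (Z <+> v)) (f (Z <+> y)) ->
  star (f (Z <+> x)) (f (Z <+> v)) (f (Z <+> y')).
Proof.
move=> px pv py py' fS.
have zv := nperp_base pv; have zy := nperp_base (nperp_base py).
have zy' := nperp_base (nperp_base py').
have xv := nperp_dot sZ pv.
have xy := nperp_dot sZ (nperp_base py); have xy' := nperp_dot sZ (nperp_base py').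
have sZx := sub_addl x sZ.
have vy := nperp_dot sZx py; have vy' := nperp_dot sZx py'.
have XV : oadj j (Z <+> x) (Z <+> v) by exact: oadj_intro.
have XY : oadj j (Z <+> x) (Z <+> y) by apply: oadj_intro => //; apply: nperp_addl.
have XY' : oadj j (Z <+> x) (Z <+> y') by apply: oadj_intro => //; apply: nperp_addl.
have VY : oadj j (Z <+> v) (Z <+> y) by apply: oadj_intro => //; apply: nperp_addl.
have VY' : oadj j (Z <+> v) (Z <+> y') by apply: oadj_intro => //; apply: nperp_addl.
have [//|YY'] := pselect (Z <+> y = Z <+> y'); first by move=> <-.
have [P [x1 [v1 [oP px1 pv1 fX fV]]]] := foa XV.
have sP := odim_sub oP.
have fXY := foa XY; have fVY := foa VY; rewrite fX in fXY; rewrite fV in fVY.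
have fXY' := foa XY'; have fVY' := foa VY'; rewrite fX in fXY'; rewrite fV in fVY'.
have [[y1 py1 fY]|[i [B [z1 [_ oB pz1 PE fY]]]]] :=
  triangle_cases oP px1 pv1 fXY fVY; last first.
  move: fS; rewrite /star fX fV (meet_addl sP px1 pv1) fY PE => h.
  by case: (@top_not_star B x1 v1 z1) => //; rewrite -?PE //; apply: odim_sub oB.
have [[e pe ->]|[i [B [z1 [kE oB pz1 PE fY']]]]] :=
  triangle_cases oP px1 pv1 fXY' fVY'.
  by rewrite /star fX fV meet_addl //; apply: addlW.
have sB := odim_sub oB; rewrite PE in px1 pv1 py1 fX fV fY.
have Bx1 := nperp_base px1; have By1 := nperp_base (nperp_base (nperp_base py1)).
have Bv1 := nperp_base (nperp_base pv1).
have zx1 := nperp_dot sB px1; have zv1 := nperp_dot sB (nperp_base pv1).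
have zy1 := nperp_dot sB (nperp_base (nperp_base py1)).
have xv1 := nperp_dot (sub_addl _ sB) pv1.
have xy1 := nperp_dot (sub_addl _ sB) (nperp_base py1).
have vy1 := nperp_dot (sub_addl _ (sub_addl _ sB)) py1.
have oBx : odim k (B <+> x1) by rewrite kE; apply: odimS.
have oBy : odim k (B <+> y1) by rewrite kE; apply: odimS.
have pxz : nperp (B <+> x1) z1 by apply: nperp_addl => //; apply: dot_sym0.
have pyz : nperp (B <+> y1) z1 by apply: nperp_addl => //; apply: dot_sym0.
pose T := B <+> x1 <+> y1.
have TX : oadj k T (f (Z <+> x)).
  apply: oadj_sym; rewrite fX addlAC; apply: oadj_intro => //.
  by do 2!apply: nperp_addl => //.
have TY : oadj k T (f (Z <+> y)).
  apply: oadj_sym; rewrite fY /T addlAC [_ <+> x1 <+> y1]addlAC; apply: oadj_intro => //.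
  by do 2!apply: nperp_addl => //; apply: dot_sym0.
have TY' : oadj k T (f (Z <+> y')).
  rewrite fY'; apply: oadj_intro => //; first exact: nperp_addl.
  by apply: nperp_addl; [exact: nperp_addl|apply: dot_sym0].
have gfK X : odim j.+1 X -> g (f X) = X by case: fg => -[_ h _] _; apply: h.
have goa X Y : oadj k X Y -> oadj j (g X) (g Y) by case: fg => _ [_ _ h]; apply: h.
have oT : odim k.+1 T by apply: oadj_od TX.
have fgT : f (g T) = T by case: fg => _ [_ h _]; apply: h.
have VX : oadj j (Z <+> x) (g T).
  by apply: oadj_sym; rewrite -[X in oadj j _ X]gfK; [apply: goa|apply: odimS].
have VYg : oadj j (Z <+> y) (g T).
  by apply: oadj_sym; rewrite -[X in oadj j _ X]gfK; [apply: goa|apply: odimS].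
have VY'g : oadj j (Z <+> y') (g T).
  by apply: oadj_sym; rewrite -[X in oadj j _ X]gfK; [apply: goa|apply: odimS].
have ZxY : nperp (Z <+> x) y by exact: nperp_addl.
have ZxY' : nperp (Z <+> x) y' by exact: nperp_addl.
(* Were [g T] the top on [x] and [y], it would also be the top on [x] and [y'], since a top does not
   contain [Z]; then [y'] would be a multiple of [y], contrary to [YY']. *)
have [[u pu gT]|[i0 [B0 [z0 [_ oB0 pz0 ZE0 gT]]]]] :=
    triangle_cases oZ px ZxY VX VYg; last first.
  have sB0 := odim_sub oB0.
  have [[u pu gT']|[i2 [B2 [z2 [_ oB2 pz2 ZE2 gT']]]]] :=
    triangle_cases oZ px ZxY' VX VY'g.
    case: (@top_not_star B0 x y z0) => //; rewrite -?ZE0 //.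
    by rewrite -gT gT'; apply: addlW.
  have gTy' : (g T) y' by rewrite gT'; apply/addl_id/sub_addl/(odim_sub oB2).
  have B0Z : B0 `<=` Z by rewrite ZE0; apply: addlW.
  have oB0y' : perp (B0 <+> x) y' by apply: perpW (proj2 ZxY'); apply: addlS.
  have oB0y : perp (B0 <+> x) y by apply: perpW (proj2 ZxY); apply: addlS.
  rewrite gT in gTy'.
  have [a ya] := addl_line (sub_addl _ sB0) oB0y gTy' oB0y'.
  case: YY'; rewrite ya addl_scale //.
  by apply: contraNneq (nperp_n0 zy') => a0; rewrite ya a0 scale0r.
have zu := nperp_base (nperp_base pu).
have xu := nperp_dot sZ (nperp_base pu); have yu := nperp_dot sZx pu.
have y'u : dot y' u = 0.
  by apply: (nperp_dot sZ); apply: oadj_star oZ zy' zu _; rewrite -gT.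
pose c := dot u v / dot v v; pose u' := u - c *: v.
have vu' : dot v u' = 0 by apply: dot_proj; apply: nperp_n0 pv.
have u'0 : u' != 0.
  apply/negP => /eqP/(canRL (subrK _)); rewrite add0r => uE.
  have c0 : c != 0 by apply: contraNneq (nperp_n0 zu) => c0; rewrite uE c0 scale0r.
  have TV : T = f (Z <+> v) by rewrite -fgT gT uE addl_scale.
  have Tx1 : T x1 by apply/addlW/addl_id.
  suff x10 : x1 = 0 by move: (nperp_n0 px1); rewrite x10 eqxx.
  apply: (perp_self (dot := dot) Tx1); rewrite TV fV.
  by apply: perp_addl (proj2 px1) _; apply: dot_sym0.
have pu' : nperp Z u'.
  split=> //; rewrite /u'; apply: (subB (sub_perp dot _)); first exact: proj2 zu.
  by apply: (subZ (sub_perp dot _)); exact: proj2 zv.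
have [xu' yu' y'u'] : [/\ dot x u' = 0, dot y u' = 0 & dot y' u' = 0].
  rewrite /u' !dot_simp xu yu y'u xv [dot y v]dot_sym0 // [dot y' v]dot_sym0 //.
  by rewrite !mulr0 oppr0 addr0.
have XU : oadj j (Z <+> x) (Z <+> u') by apply: oadj_intro => //; apply: nperp_addl.
have VU : oadj j (Z <+> v) (Z <+> u') by apply: oadj_intro => //; apply: nperp_addl.
have YU : oadj j (Z <+> y) (Z <+> u') by apply: oadj_intro => //; apply: nperp_addl.
have Y'U : oadj j (Z <+> y') (Z <+> u') by apply: oadj_intro => //; apply: nperp_addl.
have fU := star_clique (foa XV) (foa XY) (foa VY) (foa XU) (foa VU) (foa YU) fS.
exact: star_clique (foa XV) (foa XU) (foa VU) (foa XY') (foa VY')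
  (foa (oadj_sym Y'U)) fU.
Qed.

End StarTriangles.
End Triangles.

(** * The alternative between stars and tops over a fixed subspace *)

Section Stars.
Context {C : numClosedFieldType} {H : lmodType C}.
Variable dot : {dot H for conjC}.
Implicit Types (a b c : C) (u v w x y z : H) (X Y Z : set H) (n m j : nat).
Local Notation "X <+> x" := (addl X x) (at level 50, left associativity).
Local Notation nperp := (nperp dot).
Local Notation perp := (perp dot).
Local Notation odim := (odim dot).
Local Notation oadj := (oadj dot).
Local Notation room := (room dot).
Local Notation auto := (auto dot).

Lemma odim_extend n X v : odim n X -> exists m Y,
  [/\ (m <= n.+1)%N, odim m Y, X `<=` Y & Y v].
Proof.
move=> oX; have [Xv|Xv] := pselect (X v).
  by exists n, X; split.
have [p Xp op] := odim_projE v oX.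
have pv : nperp X (v - p).
  split=> //; apply/eqP => /(canRL (subrK _)); rewrite add0r => vp.
  by apply: Xv; rewrite vp.
exists n.+1, (X <+> (v - p)); split=> //; [exact: odimS|exact: addlW|].
by exists p, 1; rewrite scale1r addrC subrK.
Qed.

Lemma roomS n m : (m <= n)%N -> room n -> room m.
Proof. by move=> mn rn i X oX im; apply: rn oX _; apply: leq_trans mn. Qed.

Lemma room_avoid3 j Z u v w : room (j + 4) -> odim j Z ->
  exists2 x, nperp Z x & [/\ dot u x = 0, dot v x = 0 & dot w x = 0].
Proof.
move=> r oZ.
have [n1 [Y1 [n1j oY1 ZY1 Y1u]]] := odim_extend u oZ.
have [n2 [Y2 [n2j oY2 Y12 Y2v]]] := odim_extend v oY1.
have [n3 [Y3 [n3j oY3 Y23 Y3w]]] := odim_extend w oY2.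
have [|x px] := r _ _ oY3; first by lia.
exists x; first by apply: nperpW px => z Zz; apply/Y23/Y12/ZY1.
by split; apply: nperp_orth px _ => //; apply: Y23 => //; apply: Y12.
Qed.

Definition orth3 Z x v y := [/\ nperp Z x, nperp Z v & nperp Z y] /\
  [/\ dot x v = 0, dot x y = 0 & dot v y = 0].

Lemma orth3C Z x v y : orth3 Z x v y -> orth3 Z v x y.
Proof. by move=> [[? ? ?] [? ? ?]]; split; split=> //; apply: dot_sym0. Qed.

Lemma orth3AC Z x v y : orth3 Z x v y -> orth3 Z x y v.
Proof. by move=> [[? ? ?] [? ? ?]]; split; split=> //; apply: dot_sym0. Qed.

Lemma orth3_oadj j Z x v y : odim j Z -> orth3 Z x v y ->
  [/\ oadj j (Z <+> x) (Z <+> v), oadj j (Z <+> x) (Z <+> y) &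
      oadj j (Z <+> v) (Z <+> y)].
Proof.
by move=> oZ [[px pv py] [xv xy vy]]; split; apply: oadj_intro => //; apply: nperp_addl.
Qed.

Definition fstar (f : set H -> set H) Z x v y :=
  star (f (Z <+> x)) (f (Z <+> v)) (f (Z <+> y)).

Section OneStar.
Variables (j k : nat) (f g : set H -> set H) (Z : set H).
Hypotheses (fg : auto j k f g) (oZ : odim j Z).
Let sZ : subspace Z := odim_sub oZ.
Local Notation st := (fstar f Z).

Lemma auto_oadj X Y : oadj j X Y -> oadj k (f X) (f Y).
Proof. by case: fg => -[_ _ h] _; apply: h. Qed.

Lemma fstarC x v y : st x v y -> st v x y.
Proof. exact: starC. Qed.

Lemma fstarAC x v y : orth3 Z x v y -> st x v y -> st x y v.
Proof.
move=> /(orth3_oadj oZ)[h1 h2 h3].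
by apply: (star_swap (auto_oadj h1) (auto_oadj h2) (auto_oadj h3)).
Qed.

Lemma fstar_edge x v y y' : orth3 Z x v y -> orth3 Z x v y' ->
  st x v y -> st x v y'.
Proof.
move=> [[px pv py] [xv xy vy]] [[_ _ py'] [_ xy' vy']].
by apply: (star_edge fg oZ px); do ?[apply: nperp_addl => //].
Qed.

Hypothesis r : room (j + 4).

(** With [w] orthogonal to [x], [v] and [v'], consecutive triangles among [x v y], [x v w],
    [x w v'], [x v' y'] share an edge. *)
Lemma fstar_vertex x v y v' y' : orth3 Z x v y -> orth3 Z x v' y' ->
  st x v y -> st x v' y'.
Proof.
move=> o o' s; have [[px pv _] [xv _ _]] := o; have [[_ pv' _] [xv' _ _]] := o'.
have [w pw [xw vw v'w]] := room_avoid3 x v v' r oZ.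
have ow : orth3 Z x v w by [].
have ow' : orth3 Z x v' w by [].
have s1 := fstarAC ow (fstar_edge o ow s).
have s2 := fstar_edge (orth3AC ow) (orth3AC ow') s1.
exact: fstar_edge ow' o' (fstarAC (orth3AC ow') s2).
Qed.

(** Consecutive triangles among [x v y], [x w t], [x' w t], [x' v' y'] share a vertex, where [w] and
    [t] are orthogonal to [x] and [x']. *)
Lemma fstar_const x v y x' v' y' : orth3 Z x v y -> orth3 Z x' v' y' ->
  st x v y -> st x' v' y'.
Proof.
move=> o o' s; have [[px _ _] _] := o; have [[px' _ _] _] := o'.
have [w pw [xw x'w _]] := room_avoid3 x x' x r oZ.
have [t pt [xt x't wt]] := room_avoid3 x x' w r oZ.
have oxw : orth3 Z x w t by [].
have ox'w : orth3 Z x' w t by [].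
have s1 := fstarC (fstar_vertex o oxw s).
have s2 := fstarC (fstar_vertex (orth3C oxw) (orth3C ox'w) s1).
exact: fstar_vertex ox'w o' s2.
Qed.

Lemma orth3_exists : exists x v y, orth3 Z x v y.
Proof.
have [x px _] := room_avoid3 0 0 0 r oZ.
have [v pv [xv _ _]] := room_avoid3 x 0 0 r oZ.
have [y py [xy vy _]] := room_avoid3 x v 0 r oZ.
by exists x, v, y.
Qed.

Lemma fstar_all_or_none : (forall x v y, orth3 Z x v y -> st x v y) \/
  (forall x v y, orth3 Z x v y -> ~ st x v y).
Proof.
have [x [v [y o]]] := orth3_exists.
have [s|s] := pselect (st x v y); [left|right] => x' v' y' o'.
  exact: fstar_const o o' s.
by move=> s'; apply: s; apply: fstar_const o' o s'.
Qed.

(** [P] is the intersection of two adjacent images. A direction [y] need not be orthogonal to [x] or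
    [v], so [P] is carried to the image of [Z <+> y] through the star triangles [x v w], [w x t] and
    [w t y], each with two vertices whose images are already known to contain [P]. *)
Lemma fstar_center : (forall x v y, orth3 Z x v y -> st x v y) ->
  exists2 P, odim k P & forall X, odim j.+1 X -> Z `<=` X -> P `<=` f X.
Proof.
move=> all_st; have [x [v [y0 [[px pv _] [xv _ _]]]]] := orth3_exists.
have XV : oadj j (Z <+> x) (Z <+> v) by apply: oadj_intro => //; apply: nperp_addl.
have [P [x1 [v1 [oP px1 pv1 fX fV]]]] := auto_oadj XV.
exists P => // X oX ZX; have [y py ->] := odim_complete oZ oX ZX.
have [w pw [xw vw yw]] := room_avoid3 x v y r oZ.
have [t pt [wt xt yt]] := room_avoid3 w x y r oZ.
have PX : P `<=` f (Z <+> x) by rewrite fX; apply: addlW.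
have PV : P `<=` f (Z <+> v) by rewrite fV; apply: addlW.
have o1 : orth3 Z x v w by [].
have o2 : orth3 Z w x t by split=> //; split=> //; apply: dot_sym0.
have o3 : orth3 Z w t y by split=> //; split=> //; apply: dot_sym0.
have PW : P `<=` f (Z <+> w).
  by move=> p Pp; apply: (all_st _ _ _ o1); split; [apply: PX|apply: PV].
have PT : P `<=` f (Z <+> t).
  by move=> p Pp; apply: (all_st _ _ _ o2); split; [apply: PW|apply: PX].
by move=> p Pp; apply: (all_st _ _ _ o3); split; [apply: PW|apply: PT].
Qed.

End OneStar.

(* In the absence of stars, every vertex of a clique on an orthogonal basis of
   the complement of [Z] loses its own direction of the [j]-dimensional
   intersection [P], which leaves room for at most [j + 2] vertices. *)
Lemma star_exists j f g Z : auto j j f g -> odim j Z -> room (j + j + 3) ->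
  exists x v y, orth3 Z x v y /\ fstar f Z x v y.
Proof.
move=> fg oZ r; apply: contrapT => nost; have sZ := odim_sub oZ.
have {}nost x v y : orth3 Z x v y -> ~ fstar f Z x v y.
  by move=> o s; apply: nost; exists x, v, y.
have foa := auto_oadj fg.
have [|x px] := r _ _ oZ; first by lia.
have oX := odimS oZ px; have [|y py] := r _ _ oX; first by lia.
have oXY := odimS oX py; have xy := nperp_dot sZ py.
have XY : oadj j (Z <+> x) (Z <+> y) by apply: oadj_intro.
have [P [x1 [y1 [oP px1 py1 fX fY]]]] := foa _ _ XY.
have sP := odim_sub oP.
have top w : nperp (Z <+> x <+> y) w -> exists i B z,
  [/\ j = i.+1, odim i B, nperp B z, P = B <+> z & f (Z <+> w) = B <+> x1 <+> y1].
  move=> pw; have zw := nperp_base (nperp_base pw).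
  have yw := nperp_dot (sub_addl _ sZ) pw; have xw := nperp_dot sZ (nperp_base pw).
  have o : orth3 Z x y w by split; split=> //; apply: nperp_base py.
  have [_ XW YW] := orth3_oadj oZ o.
  have := foa _ _ XW; have := foa _ _ YW; rewrite fX fY => fYW fXW.
  have [[e pe E]|//] := triangle_cases oP px1 py1 fXW fYW.
  case: (nost _ _ _ o); rewrite /fstar /star fX fY (meet_addl sP px1 py1) E.
  exact: addlW.
(* [D] collects the lost directions of [P] and [E] the vectors used. The last [w] is orthogonal to a
   space of dimension [j + 2 + j], whence the bound [j + j + 3]; the resulting [D] has dimension
   [j.+1], too large for [P]. *)
have chain i : (i <= j.+1)%N -> exists D E, [/\ odim i D, D `<=` P,
    odim (j + 2 + i) E, Z <+> x <+> y `<=` E &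
    forall w, nperp E w -> D `<=` f (Z <+> w)].
  elim: i => [_|i IHi ij].
    exists [set 0], (Z <+> x <+> y); split=> //; first exact: odim0.
    - by move=> _ ->; apply: sub0.
    - by rewrite addn0 addn2.
    move=> w pw _ ->; have [i [B [z [_ oB _ _ ->]]]] := top w pw.
    by apply: sub0; do 2!apply: sub_addl; apply: odim_sub oB.
  have [|D [E [oD DP oE XYE DW]]] := IHi; first by lia.
  have sE := odim_sub oE.
  have [|w pw] := r _ _ oE; first by lia.
  have pXYw := nperpW XYE pw.
  have [l [B [z [jl oB pz PE fW]]]] := top w pXYw.
  have sB := odim_sub oB; rewrite PE in px1 py1 fX fY.
  have pBx1 := nperp_base px1; have pBy1 := nperp_base (nperp_base py1).
  have zx1 := nperp_dot sB px1; have zy1 := nperp_dot sB (nperp_base py1).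
  have x1y1 := nperp_dot (sub_addl _ sB) py1.
  have pWz : nperp (B <+> x1 <+> y1) z.
    by do 2!(apply: nperp_addl; last exact: dot_sym0).
  exists (D <+> z), (E <+> w); split.
  - by apply: odimS => //; apply: nperpW pWz; rewrite -fW; apply: DW.
  - apply: addl_least => //; rewrite PE; exact: addl_id.
  - by rewrite addnS; apply: odimS.
  - by move=> t /XYE; apply: addlW.
  move=> w' pw'; have pE' := nperp_base pw'; have ww' := nperp_dot sE pw'.
  have [l' [B' [z' [_ oB' pz' _ fW']]]] := top w' (nperpW XYE pE').
  have zw := nperp_base (nperp_base pXYw).
  have zw' := nperp_base (nperp_base (nperpW XYE pE')).
  have xw := nperp_dot sZ (nperp_base pXYw).
  have xw' := nperp_dot sZ (nperp_base (nperpW XYE pE')).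
  have o : orth3 Z x w w' by split=> //; split=> //; apply: ww'.
  have [XW XW' WW'] := orth3_oadj oZ o.
  have fXW' := foa _ _ XW'; have fWW' := foa _ _ WW'.
  rewrite fX addlAC in fXW'; rewrite fW in fWW'.
  have oBx : odim j (B <+> x1) by rewrite jl; apply: odimS.
  have pBxz := nperp_swap sB pz px1.
  have pBxzy : nperp (B <+> x1 <+> z) y1 by rewrite addlAC.
  have sfW' : subspace (f (Z <+> w')) by rewrite fW'; apply/sub_addl/sub_addl/(odim_sub oB').
  apply: addl_least => //; first exact: DW.
  (* The images of [Z <+> x] and [Z <+> w] are [B <+> x1 <+> z] and [B <+> x1 <+> y1]. The triangle
     with [w'] is mapped to a top, so the image of [Z <+> w'] contains [z]. *)
  have [[e pe E']|[l2 [B2 [z2 [_ oB2 _ _ ->]]]]] :=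
      triangle_cases oBx pBxz pBxzy fXW' fWW'; last first.
    by apply/addlW/addl_id/(odim_sub oB2).
  case: (nost _ _ _ o); rewrite /fstar /star fX fW addlAC.
  rewrite (meet_addl (sub_addl _ sB) pBxz pBxzy) E'; exact: addlW.
have [D [E [oD DP _ _ _]]] := chain _ (leqnn _).
by have := odim_le oD oP DP; rewrite ltnn.
Qed.

End Stars.

(** * Descent to smaller subspaces *)

Section Descent.
Context {C : numClosedFieldType} {H : lmodType C}.
Variable dot : {dot H for conjC}.
Implicit Types (a b c : C) (u v w x y z : H) (X Y Z : set H) (n m j : nat).
Local Notation "X <+> x" := (addl X x) (at level 50, left associativity).
Local Notation nperp := (nperp dot).
Local Notation perp := (perp dot).
Local Notation odim := (odim dot).
Local Notation oadj := (oadj dot).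
Local Notation room := (room dot).
Local Notation auto := (auto dot).
Local Notation star := (@star C H).
Local Notation fstar := (@fstar C H).
Local Notation orth3 := (orth3 dot).
Local Notation half_auto := (half_auto dot).

Definition all_star f j := forall Z x v y, odim j Z -> orth3 Z x v y -> fstar f Z x v y.

(* Orthogonal [Z1 = A + x] and [Z2 = A + y] are detected by the top triangle
   [A + x + y], [Z1 + w], [Z2 + w], whose edges at the first vertex meet in [Z1]
   and [Z2]. *)
Lemma half_auto_descend j k f g f' g' : auto j.+1 k.+1 f g -> room (j + 5) ->
    (forall Z, odim j.+1 Z -> odim k.+1 (f' Z)) ->
    (forall Z X, odim j.+1 Z -> odim j.+2 X -> Z `<=` X -> f' Z `<=` f X) ->
    (forall Z, odim k.+1 Z -> odim j.+1 (g' Z)) ->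
    (forall Z X, odim k.+1 Z -> odim k.+2 X -> Z `<=` X -> g' Z `<=` g X) ->
  half_auto j k f' g'.
Proof.
move=> fg r f'o f'f g'o g'g.
have foa := auto_oadj fg.
have fo X : odim j.+2 X -> odim k.+2 (f X) by case: fg => -[h _ _] _; apply: h.
have gfK X : odim j.+2 X -> g (f X) = X by case: fg => -[_ h _] _; apply: h.
(* [g' (f' Z)] lies in every vertex containing [Z], and two of these already meet in [Z]. *)
have gfK' Z : odim j.+1 Z -> g' (f' Z) = Z.
  move=> oZ; have oZ' := f'o _ oZ; have sZ := odim_sub oZ.
  have [|x px] := r _ _ oZ; first by lia.
  have [|y py] := r _ _ (odimS oZ px); first by lia.
  have zy := nperp_base py.
  apply: (odim_sameE (g'o _ oZ') oZ); rewrite -{2}(meet_addl sZ px py) => w gw.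
  have h t : nperp Z t -> (Z <+> t) w.
    move=> pt; rewrite -(gfK _ (odimS oZ pt)).
    apply: g'g gw => //; first exact/fo/odimS.
    by apply: f'f => //; [exact: odimS|exact: addlW].
  by split; apply: h.
split=> // _ _ [A [x [y [oA px py -> ->]]]]; have sA := odim_sub oA.
have [|w pw] := r _ _ (odimS (odimS oA px) py); first by lia.
have xy := nperp_dot sA py; have yw := nperp_dot (sub_addl _ sA) pw.
have xw := nperp_dot sA (nperp_base pw).
have [Ay Aw] := (nperp_base py, nperp_base (nperp_base pw)).
have oZ1 := odimS oA px; have oZ2 := odimS oA Ay; have oAw := odimS oA Aw.
have XX1 : oadj j.+1 (A <+> x <+> y) (A <+> x <+> w).
  by apply: oadj_intro => //.
have XX2 : oadj j.+1 (A <+> x <+> y) (A <+> y <+> w).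
  rewrite addlAC; apply: oadj_intro => //; first exact: nperp_swap.
  by rewrite addlAC.
have X12 : oadj j.+1 (A <+> x <+> w) (A <+> y <+> w).
  rewrite !(addlAC A _ w); apply: oadj_intro => //; first exact: nperp_swap (nperp_base pw).
  by rewrite (addlAC A w x); apply: nperp_addl (nperp_addl _ _) _ => //; apply: dot_sym0.
have [oX oX1 oX2] : [/\ odim j.+2 (A <+> x <+> y), odim j.+2 (A <+> x <+> w) &
    odim j.+2 (A <+> y <+> w)].
  by split; [apply: oadj_od XX1|apply: oadj_od X12|apply: oadj_od (oadj_sym X12)].
have fne : f' (A <+> x) <> f' (A <+> y).
  move=> /(congr1 g'); rewrite !gfK' //; apply: oadj_neq.
  exact: (oadj_intro oA px py).
have Z1X : f' (A <+> x) `<=` f (A <+> x <+> y) by apply: f'f => //; apply: addlW.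
have Z1X1 : f' (A <+> x) `<=` f (A <+> x <+> w) by apply: f'f => //; apply: addlW.
have Z2X : f' (A <+> y) `<=` f (A <+> x <+> y).
  by apply: f'f => //; rewrite addlAC; apply: addlW.
have Z2X2 : f' (A <+> y) `<=` f (A <+> y <+> w) by apply: f'f => //; apply: addlW.
have [P [a [b [oP pa pb fX fX1]]]] := foa _ _ XX1.
have sP := odim_sub oP; rewrite fX in Z1X Z2X; rewrite fX1 in Z1X1.
have PE : f' (A <+> x) = P.
  apply: (odim_sameE (f'o _ oZ1) oP) => t ft.
  by apply: (addl_inter sP pa pb); [apply: Z1X|apply: Z1X1].
have fXX2 := foa _ _ XX2; have fX12 := foa _ _ X12.
rewrite fX in fXX2; rewrite fX1 in fX12.
(* If the image triangle were a star, [P] would be the image of both [A <+> x] and [A <+> y],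
   against the injectivity of [f']. *)
have [[e pe fX2]|[i [B [z [[ki] oB pz PB fX2]]]]] := triangle_cases oP pa pb fXX2 fX12.
  case: fne; rewrite PE; symmetry; apply: (odim_sameE (f'o _ oZ2) oP) => t ft.
  by apply: (addl_inter sP pa (nperp_base pe)); [apply: Z2X|rewrite -fX2; apply: Z2X2].
rewrite -ki in oB; rewrite PB in pa pb; have sB := odim_sub oB.
suff -> : f' (A <+> y) = B <+> a by rewrite PE PB; apply: oadj_intro.
apply: (odim_sameE (f'o _ oZ2) (odimS oB (nperp_base pa))) => t ft.
apply: (addl_inter (sub_addl _ sB) (nperp_swap sB pz pa) (y := b)).
- by rewrite addlAC.
- by rewrite addlAC -PB; apply: Z2X.
- by rewrite -fX2; apply: Z2X2.
Qed.

(** [f' Z] is the common part of the images of all vertices containing [Z], given by [fstar_center];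
    the same construction for [g] yields the inverse. The bound [j + 5] is [j.+1 + 4], for stars
    over subspaces of dimension [j.+1]. *)
Lemma auto_descend j k f g : auto j.+1 k.+1 f g -> room (j + 5) -> room (k + 5) ->
    all_star f j.+1 -> all_star g k.+1 ->
  exists f' g', auto j k f' g' /\
    forall Z X, odim j.+1 Z -> odim j.+2 X -> Z `<=` X -> f' Z `<=` f X.
Proof.
have main j1 k1 f1 g1 : auto j1.+1 k1.+1 f1 g1 -> room (j1 + 5) -> all_star f1 j1.+1 ->
    exists f', forall Z, odim j1.+1 Z -> odim k1.+1 (f' Z) /\
      forall X, odim j1.+2 X -> Z `<=` X -> f' Z `<=` f1 X.
  move=> fg r sf.
  have /choice[f' f'P] : forall Z, exists P, odim j1.+1 Z -> odim k1.+1 P /\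
      forall X, odim j1.+2 X -> Z `<=` X -> P `<=` f1 X.
    move=> Z; have [oZ|] := pselect (odim j1.+1 Z); last by exists setT.
    have [|P oP PX] := fstar_center fg oZ _ (fun x v y => @sf Z x v y oZ).
      by apply: roomS r; lia.
    by exists P.
  by exists f'.
move=> fg rj rk sf sg; have [f' f'P] := main _ _ _ _ fg rj sf.
have [g' g'P] := main _ _ _ _ (auto_sym fg) rk sg.
have fo Z : odim j.+1 Z -> odim k.+1 (f' Z) by case/f'P.
have go Z : odim k.+1 Z -> odim j.+1 (g' Z) by case/g'P.
have ff Z X : odim j.+1 Z -> odim j.+2 X -> Z `<=` X -> f' Z `<=` f X.
  by case/f'P => _; apply.
have gg Z X : odim k.+1 Z -> odim k.+2 X -> Z `<=` X -> g' Z `<=` g X.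
  by case/g'P => _; apply.
exists f', g'; split=> //; split; first exact: half_auto_descend fg rj fo ff go gg.
exact: half_auto_descend (auto_sym fg) rk go gg fo ff.
Qed.

End Descent.

(** * Orthogonal complements and the case dim H = 2k *)

Section Complement.
Context {C : numClosedFieldType} {H : lmodType C}.
Variable dot : {dot H for conjC}.
Implicit Types (a b c : C) (u v w x y z : H) (X Y Z : set H) (n m j : nat).
Local Notation "X <+> x" := (addl X x) (at level 50, left associativity).
Local Notation nperp := (nperp dot).
Local Notation perp := (perp dot).
Local Notation odim := (odim dot).
Local Notation oadj := (oadj dot).
Local Notation room := (room dot).
Local Notation auto := (auto dot).
Local Notation fstar := (@fstar C H).
Local Notation orth3 := (orth3 dot).
Local Notation all_star := (all_star dot).

Lemma nperp_exists m X Y : odim m X -> subspace Y -> X `<=` Y -> X <> Y ->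
  exists x, nperp X x /\ Y x.
Proof.
move=> oX sY XY nXY.
have [v [Yv Xv]] : exists v, Y v /\ ~ X v.
  apply: contrapT => h; apply: nXY; apply/seteqP; split=> // v Yv.
  by apply: contrapT => Xv; apply: h; exists v.
have [p Xp op] := odim_projE v oX; exists (v - p); split.
  split=> //; apply/eqP => /(canRL (subrK _)); rewrite add0r => vp.
  by apply: Xv; rewrite vp.
by apply: (subB sY) => //; apply: XY.
Qed.

Lemma sub_setT : subspace (setT : set H). Proof. by split. Qed.

Lemma odim_room n : odim n setT -> room n.
Proof.
move=> oT m X oX mn; have [XT|XT] := pselect (X = setT).
  by move: mn; rewrite XT in oX; rewrite (odim_dim oX oT) ltnn.
by have [|x [px _]] := nperp_exists oX sub_setT _ XT; last by exists x.
Qed.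

Lemma odim_grow n m X : room n -> odim m X -> (m <= n)%N ->
  exists2 Y, odim n Y & X `<=` Y.
Proof.
move=> r; move: {2}(n - m)%N (erefl (n - m)%N) => d.
elim: d m X => [|d IHd] m X dE oX mn.
  by exists X => //; have -> : n = m by lia.
have [|x px] := r _ _ oX; first by lia.
have [||Y oY XY] := IHd m.+1 (X <+> x) _ (odimS oX px); [lia|lia|].
by exists Y => // w Xw; apply/XY/addlW.
Qed.

Lemma perp_addlE X x : subspace X -> nperp X x -> perp X = perp (X <+> x) <+> x.
Proof.
move=> sX px; rewrite -{1}(hyp_addlE dot (sub_perp dot X) (proj2 px) (nperp_n0 px)).
congr (_ <+> x); apply/seteqP; split=> [w [ow xw]|w ow]; first exact: perp_addl.
by split; [apply: perpW ow; apply: addlW|apply: ow; apply: addl_id].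
Qed.

(** Induction on the codimension: passing from [X] to [X <+> x] removes exactly the direction [x]
    from the complement. *)
Lemma odim_perp n m X : odim n setT -> odim m X -> odim (n - m) (perp X).
Proof.
move=> oT; move: {2}(n - m)%N (erefl (n - m)%N) => d.
elim: d m X => [|d IHd] m X dE oX; have mn := odim_le oX oT (@subsetT _ _).
  have nm : n = m by lia.
  have -> : X = setT by apply: odim_sameE oT _ => //; rewrite nm.
  rewrite dE; suff -> : perp setT = [set 0] by apply: odim0.
  apply/seteqP; split=> [w ow|_ ->]; last by apply: sub0; apply: sub_perp.
  exact: (perp_self (X := setT) _ ow).
have [|x px] := odim_room oT oX; first by lia.
rewrite dE (perp_addlE (odim_sub oX) px); apply: odimS.
  have -> : d = (n - m.+1)%N by lia.
  by apply: IHd (odimS oX px); lia.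
split; first exact: nperp_n0 px.
by move=> w ow; apply/dot_sym0/ow/addl_id/(odim_sub oX).
Qed.

(** The complements of [Z <+> x] and [Z <+> y] arise from that of [Z <+> x <+> y] by adding [y] and
    [x] respectively. Sums and intersections exchange roles, and with them tops and stars. *)
Lemma oadj_perp j k X Y : odim (j + k + 2) setT -> oadj j X Y -> oadj k (perp X) (perp Y).
Proof.
move=> oT [Z [x [y [oZ px py -> ->]]]]; have sZ := odim_sub oZ.
have pyx := nperp_swap sZ px py; have zy := nperp_base py.
rewrite (perp_addlE (sub_addl x sZ) py) (perp_addlE (sub_addl y sZ) pyx).
rewrite (addlAC Z y x); apply: oadj_intro.
- have -> : k = (j + k + 2 - j.+2)%N by lia.
  exact: odim_perp oT (odimS (odimS oZ px) py).
- split; first exact: nperp_n0 py.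
  by move=> w ow; apply/dot_sym0/ow/addl_id/sub_addl.
- split; first exact: nperp_n0 px.
  apply: perp_addl; last exact/dot_sym0/(nperp_dot sZ).
  by move=> w ow; apply/dot_sym0/ow/addlW/addl_id.
Qed.

Lemma auto_perp j k : odim (j + k + 2) setT -> auto j k perp perp.
Proof.
have half j1 k1 : odim (j1 + k1 + 2) setT -> half_auto dot j1 k1 perp perp.
  move=> oT; split=> [X oX|X oX|X Y]; last exact: oadj_perp.
    have -> : k1.+1 = (j1 + k1 + 2 - j1.+1)%N by lia.
    exact: odim_perp.
  exact: perp_perpE oX.
move=> oT; split; apply: half => //; by rewrite (addnC k).
Qed.

Lemma auto_comp j k l f g f' g' : auto j k f g -> auto k l f' g' ->
  auto j l (f' \o f) (g \o g').
Proof.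
have half j1 k1 l1 f1 g1 f2 g2 : half_auto dot j1 k1 f1 g1 ->
    half_auto dot k1 l1 f2 g2 -> half_auto dot j1 l1 (f2 \o f1) (g1 \o g2).
  move=> [o1 K1 a1] [o2 K2 a2]; split=> [X oX|X oX|X Y XY] /=.
  - exact/o2/o1.
  - by rewrite K2 ?K1 //; apply: o1.
  - exact/a2/a1.
by move=> [fg gf] [fg' gf']; split; [apply: half fg fg'|apply: half gf' gf].
Qed.

Lemma star_perp j X Y D : oadj j X Y -> oadj j X D -> oadj j Y D -> ~ star X Y D ->
  star (perp X) (perp Y) (perp D).
Proof.
move=> [Z [x [y [oZ px py -> ->]]]] XD YD; have sZ := odim_sub oZ.
rewrite /star (meet_addl sZ px py) => ZD.
have [[d pd DZ]|[i [B [z [_ oB pz ZE DB]]]]] := triangle_cases oZ px py XD YD.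
  by case: ZD; rewrite DZ; apply: addlW.
move=> w [ow ow']; rewrite DB; apply: perp_addl; last exact/ow'/addl_id.
by apply: perpW ow; apply: addlS; rewrite ZE; apply: addlW.
Qed.

Definition tri j X Y D := [/\ oadj j X Y, oadj j X D & oadj j Y D].

Lemma tri_auto j k f g X Y D : auto j k f g -> tri j X Y D ->
  tri k (f X) (f Y) (f D).
Proof. by move=> fg [h1 h2 h3]; split; apply: (auto_oadj fg). Qed.

Lemma tri_AC j X Y D : tri j X Y D -> tri j X D Y.
Proof. by move=> [h1 h2 h3]; split=> //; apply: oadj_sym. Qed.

(** [star_edge] without reference to directions, so that it applies to triangles known only as
    images. *)
Lemma star_edge_set j k f g X V Y Y' : auto j k f g ->
    tri j X V Y -> tri j X V Y' -> star X V Y -> star X V Y' ->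
  star (f X) (f V) (f Y) -> star (f X) (f V) (f Y').
Proof.
move=> fg [[Z [x [v [oZ px pv -> ->]]]] XY VY] [_ XY' VY']; have sZ := odim_sub oZ.
rewrite /star (meet_addl sZ px pv) => ZY ZY'.
have ppv W : oadj j (Z <+> x) W -> oadj j (Z <+> v) W -> Z `<=` W ->
    exists2 y, nperp (Z <+> x <+> v) y & W = Z <+> y.
  move=> XW VW ZW; have [y py E] := oadj_inter oZ px XW ZW.
  exists y => //; apply: (nperp_addl py); apply: (nperp_dot sZ).
  by apply: (oadj_star oZ (nperp_base pv) (nperp_base py)); rewrite -E.
have [y py ->] := ppv _ XY VY ZY; have [y' py' ->] := ppv _ XY' VY' ZY'.
exact: (star_edge fg oZ px pv py py').
Qed.

Lemma auto_perp_comp j f g : odim (j + j + 2) setT -> auto j j f g ->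
  auto j j (perp \o f) (g \o perp).
Proof. by move=> oT fg; apply: auto_comp fg _; apply: auto_perp. Qed.

(* The top triangle [A + x + y], [A + x + w], [A + y + w] shares an edge with a
   star over [Z1] and another with a star over [Z2], so its image has the type
   opposite to both. *)
Lemma all_star_step j f g Z1 Z2 : auto j.+1 j.+1 f g ->
    odim (j.+1 + j.+1 + 2) setT -> (1 < j.+1)%N -> oadj j Z1 Z2 ->
    (forall x v y, orth3 Z1 x v y -> fstar f Z1 x v y) ->
  forall x v y, orth3 Z2 x v y -> fstar f Z2 x v y.
Proof.
move=> fg oT j2 Z12 S1.
have oZ2 := oadj_od (oadj_sym Z12); have r := odim_room oT.
(* Here [1 < j.+1] is used: it amounts to [j.+1 + 4 <= j.+1 + j.+1 + 2]. *)
have r4 : room (j.+1 + 4) by apply: roomS r; lia.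
have [//|S2] := fstar_all_or_none fg oZ2 r4.
case: Z12 S1 S2 oZ2 => A [x [y [oA px py -> ->]]] S1 S2 _.
have sA := odim_sub oA.
have [|w pw] := r _ _ (odimS (odimS oA px) py); first by lia.
have [|v pv] := r _ _ (odimS (odimS (odimS oA px) py) pw); first by lia.
have s2 := sub_addl y (sub_addl x sA).
have wv := nperp_dot s2 pv; have pv' := nperp_base pv.
have Ay := nperp_base py; have Ayx := nperp_swap sA px py.
have [yw yv] := (nperp_dot (sub_addl _ sA) pw, nperp_dot (sub_addl _ sA) pv').
have [xw xv] := (nperp_dot sA (nperp_base pw), nperp_dot sA (nperp_base pv')).
have o1 : orth3 (A <+> x) y w v.
  by split; [split=> //; [apply: nperp_base pw|apply: nperp_base pv']|].
have o2 : orth3 (A <+> y) x w v.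
  by split=> //; split=> //; apply: nperp_addl => //;
    [apply: nperp_base (nperp_base pw)|apply: nperp_base (nperp_base pv')].
have [oZ1 oZ2] := (odimS oA px, odimS oA Ay).
have T1 : tri j.+1 (A <+> x <+> y) (A <+> x <+> w) (A <+> x <+> v).
  exact: orth3_oadj oZ1 o1.
have T2 : tri j.+1 (A <+> x <+> y) (A <+> y <+> w) (A <+> y <+> v).
  by rewrite addlAC; apply: orth3_oadj oZ2 o2.
have T12 : tri j.+1 (A <+> x <+> y) (A <+> x <+> w) (A <+> y <+> w).
  case: T1 T2 => [h1 _ _] [h2 _ _]; split=> //.
  rewrite !(addlAC A _ w).
  have Aw := nperp_base (nperp_base pw).
  apply: oadj_intro; first exact: odimS.
    by apply: nperp_addl => //; apply: dot_sym0.
  exact: (nperp_addl (nperp_addl Ay (dot_sym0 yw)) (nperp_dot sA py)).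
have fT1 := tri_auto fg T1; have fT2 := tri_auto fg T2.
have fT12 := tri_auto fg T12.
have gfK X Y D : tri j.+1 X Y D -> [/\ g (f X) = X, g (f Y) = Y & g (f D) = D].
  move=> [XY XD _]; case: fg => -[_ h _] _; split; apply: h.
  - exact: oadj_od XY.
  - exact: oadj_od (oadj_sym XY).
  - exact: oadj_od (oadj_sym XD).
have sA1 := sub_addl x sA; have sA2 := sub_addl y sA.
have s1 : star (A <+> x <+> y) (A <+> x <+> w) (A <+> x <+> v).
  by rewrite /star (meet_addl sA1 py pw); apply: addlW.
have pxw : nperp (A <+> y <+> x) w by rewrite addlAC.
have s2' : star (A <+> x <+> y) (A <+> y <+> w) (A <+> y <+> v).
  by rewrite /star addlAC (meet_addl sA2 Ayx pxw); apply: addlW.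
have n1 : ~ star (A <+> x <+> y) (A <+> x <+> w) (A <+> y <+> w).
  rewrite /star (meet_addl sA1 py pw) => /(_ x (addl_id x sA)) h.
  suff x0 : x = 0 by move: (nperp_n0 px); rewrite x0 eqxx.
  apply: (perp_self (dot := dot) h); apply: perp_addl; last exact: dot_sym0.
  exact: proj2 Ayx.
have n2 : ~ star (A <+> x <+> y) (A <+> y <+> w) (A <+> x <+> w).
  rewrite /star addlAC (meet_addl sA2 Ayx pxw) => /(_ y (addl_id y sA)) h.
  suff y0 : y = 0 by move: (nperp_n0 py); rewrite y0 eqxx.
  apply: (perp_self (dot := dot) h); apply: perp_addl; last exact: dot_sym0.
  exact: proj2 py.
have [s|ns] := pselect (star (f (A <+> x <+> y)) (f (A <+> x <+> w)) (f (A <+> y <+> w))).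
  have := star_edge_set (auto_sym fg) fT1 fT12 (S1 _ _ _ o1) s.
  by have [-> -> ->] := gfK _ _ _ T1; have [_ _ ->] := gfK _ _ _ T12 => /(_ s1).
(* The images of [T2] and [T12] are now both tops. Complementation turns them into stars, so the
   edge argument runs for [g \o perp]. *)
have ofg := auto_sym (auto_perp_comp oT fg).
have oK X : odim j.+2 X -> perp (perp X) = X by move=> oX; apply: perp_perpE oX.
have hK X Y D : tri j.+1 X Y D -> tri j.+1 (f X) (f Y) (f D) ->
    [/\ (g \o perp) (perp (f X)) = X,
    (g \o perp) (perp (f Y)) = Y & (g \o perp) (perp (f D)) = D].
  move=> t [h1 h2 _]; have [e1 e2 e3] := gfK _ _ _ t.
  by rewrite /= !oK ?e1 ?e2 ?e3 //; [exact: oadj_od (oadj_sym h2)|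
     exact: oadj_od (oadj_sym h1)|exact: oadj_od h1].
have ofT2 := tri_auto (auto_perp oT) fT2.
have ofT12 := tri_auto (auto_perp oT) (tri_AC fT12).
have so2 : star (perp (f (A <+> x <+> y))) (perp (f (A <+> y <+> w)))
    (perp (f (A <+> y <+> v))).
  case: fT2 => h1 h2 h3; apply: star_perp h1 h2 h3 _.
  by have := S2 _ _ _ o2; rewrite /fstar (addlAC A y x).
have so12 : star (perp (f (A <+> x <+> y))) (perp (f (A <+> y <+> w)))
    (perp (f (A <+> x <+> w))).
  case: (tri_AC fT12) => h1 h2 h3; apply: (star_perp h1 h2 h3).
  by move=> s; apply: ns; apply: (star_swap h1 h2 h3).
have := star_edge_set ofg ofT2 ofT12 so2 so12.
have [-> -> ->] := hK _ _ _ T2 fT2.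
by have [_ _ ->] := hK _ _ _ (tri_AC T12) (tri_AC fT12) => /(_ s2').
Qed.

(** Induction on the codimension [l] of a common subspace [A]. For [l = 1] a vertex [A <+> w] with
    [w] orthogonal to both ends is adjacent to both. For larger [l] a subspace [Z1] containing [A],
    a new vector of [Z] and a new vector of [Z'] shares a larger subspace with each end. *)
Lemma oadj_connected i (P : set H -> Prop) : room (i + 3) ->
    (forall Z Z', oadj i Z Z' -> P Z -> P Z') ->
  forall Z Z', odim i.+1 Z -> odim i.+1 Z' -> P Z -> P Z'.
Proof.
move=> r PP Z Z'; suff main l (a : nat) A : (l + a = i.+1)%N -> odim a A ->
    forall Z Z', A `<=` Z -> A `<=` Z' -> odim i.+1 Z -> odim i.+1 Z' -> P Z -> P Z'.
  move=> oZ oZ'; apply: (main i.+1 0%N [set 0]) => //; [by rewrite addn0|exact: odim0|..].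
    by move=> _ ->; apply: (sub0 (odim_sub oZ)).
  by move=> _ ->; apply: (sub0 (odim_sub oZ')).
elim: l a A => [|l IHl] a A lai oA {}Z {}Z' AZ AZ' oZ oZ' PZ.
  rewrite add0n in lai; rewrite lai in oA.
  by rewrite -(odim_sameE oA oZ' AZ') (odim_sameE oA oZ AZ).
case: l IHl lai => [|l] IHl lai.
  have {lai} ai : a = i by lia.
  rewrite {}ai in oA; have [x px ZE] := odim_complete oA oZ AZ.
  have [y py ZE'] := odim_complete oA oZ' AZ'.
  have [n [Y [ni oY ZY Yy]]] := odim_extend y oZ.
  have [|w pw] := r _ _ oY; first by lia.
  have AY : A `<=` Y by move=> t /AZ /ZY.
  have Yx : Y x by apply: ZY; rewrite ZE; apply/addl_id/(odim_sub oA).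
  have [xw yw] : dot x w = 0 /\ dot y w = 0 by split; apply: nperp_orth pw _.
  apply: (PP (A <+> w)).
    rewrite ZE'; apply: oadj_sym; apply: oadj_intro => //.
    by apply: nperp_addl => //; apply: nperpW pw.
  apply: PP PZ; rewrite ZE; apply: oadj_intro => //.
  by apply: nperp_addl => //; apply: nperpW pw.
have [x [px Zx]] : exists x, nperp A x /\ Z x.
  apply: (nperp_exists oA (odim_sub oZ) AZ) => E; move: oA; rewrite E => oA.
  by have := odim_dim oA oZ; lia.
have [y [py Zy]] : exists y, nperp A y /\ Z' y.
  apply: (nperp_exists oA (odim_sub oZ') AZ') => E; move: oA; rewrite E => oA.
  by have := odim_dim oA oZ'; lia.
have [n [W [na oW AW Wy]]] := odim_extend y (odimS oA px).
have [||Z1 oZ1 WZ1] := odim_grow (n := i.+1) _ oW; [by apply: roomS r; lia|lia|].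
have AxZ1 : A <+> x `<=` Z1 by move=> t /AW /WZ1.
have sA := odim_sub oA.
apply: (IHl _ _ _ (odimS oA py) Z1) => //; first by lia.
- apply: addl_least; [exact: odim_sub oZ1| |exact: WZ1].
  by move=> t At; apply/AxZ1/addlW.
- by apply: addl_least => //; exact: odim_sub oZ'.
apply: (IHl _ _ _ (odimS oA px) Z) => //; first by lia.
by apply: addl_least => //; exact: odim_sub oZ.
Qed.

End Complement.

(** * Automorphisms of the orthogonality graph of lines *)

Section Uhlhorn.
Context {C : numClosedFieldType} {H : lmodType C}.
Variable dot : {dot H for conjC}.
Implicit Types (a b c l : C) (u v w x y z : H).

(** Treats unitary and anti-unitary operators at once: the [s] that occur turn out to be the
    identity or the conjugation. *)
Definition semiunitary (s : C -> C) (U : H -> H) :=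
  [/\ bijective U, forall x y, U (x + y) = U x + U y,
      forall a x, U (a *: x) = s a *: U x &
      forall x y, dot (U x) (U y) = s (dot x y)].

(** [F x] stands for a spanning vector of the image of the line of [x]. The choice is arbitrary, so
    the hypotheses are invariant under rescaling by nonzero factors. *)
Variable F : H -> H.
Hypothesis F_neq0 : forall x, x != 0 -> F x != 0.
Hypothesis F_orth : forall x y, x != 0 -> y != 0 ->
  dot x y = 0 <-> dot (F x) (F y) = 0.
Hypothesis F_surj : forall y, y != 0 -> exists x a, [/\ x != 0, a != 0 & y = a *: F x].

(** The component [p] of [z] orthogonal to [F x] is some [a *: F u] with [u] orthogonal to [x], and
    <p,p> is the conjugate of <z,p>, so both vanish together. Orthogonality to [F u] is asked only
    for such [u], whose relation to [z] may carry further information, as in [TF]. *)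
Let colin x z : x != 0 ->
  (forall u a, u != 0 -> a != 0 -> dot x u = 0 -> (exists b, a *: F u = z - b *: F x) ->
     dot z (F u) = 0) ->
  exists a, z = a *: F x.
Proof.
move=> x0 zF; pose b := dot z (F x) / dot (F x) (F x).
pose p := z - b *: F x; have Fx0 := F_neq0 x0.
have Fp : dot (F x) p = 0 by apply: dot_proj.
exists b; apply/eqP; rewrite -subr_eq0 -/p; apply/eqP.
have [//|p0] := eqVneq p 0; have [u [a [u0 a0 pE]]] := F_surj p0.
have xu : dot x u = 0.
  apply/(F_orth x0 u0); move/eqP: Fp; rewrite pE dotZr mulf_eq0 conjC_eq0 (negPf a0).
  by move/eqP.
apply: (@dotxx0 _ _ dot); rewrite {1}/p dotBl dotZl Fp mulr0 subr0 pE dotZr.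
by rewrite (zF u a) ?mulr0 //; exists b; rewrite -pE.
Qed.

Let FZ a x : a != 0 -> x != 0 -> exists2 b, b != 0 & F (a *: x) = b *: F x.
Proof.
move=> a0 x0; have ax0 : a *: x != 0 by rewrite scaler_eq0 negb_or a0.
have [u c u0 _ xu _|b E] := colin (z := F (a *: x)) x0 _.
  by apply/(F_orth ax0 u0); rewrite dotZl xu mulr0.
by exists b => //; apply: contraNneq (F_neq0 ax0) => b0; rewrite E b0 scale0r.
Qed.

Variables (e e' : H) (k0 : C).
Hypotheses (ee : dot e e = 1) (e'e' : dot e' e' = 1) (k00 : k0 != 0).
Hypothesis Fe : F e = k0 *: e'.

Let e0 : e != 0.
Proof. by rewrite -(dot_eq0 dot) ee oner_eq0. Qed.

Let orth_e u : u != 0 -> dot u e = 0 <-> dot (F u) e' = 0.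
Proof.
move=> u0; have [h1 h2] := F_orth u0 e0; split=> [/h1|h].
  by rewrite Fe dotZr => /eqP; rewrite mulf_eq0 conjC_eq0 (negPf k00) => /eqP.
by apply: h2; rewrite Fe dotZr h mulr0.
Qed.

Let ev_e v : dot v e = 0 -> dot (e + v) e = 1.
Proof. by move=> ve; rewrite dotDl ee ve addr0. Qed.

Let ev_neq0 v : dot v e = 0 -> e + v != 0.
Proof.
move=> /ev_e h; apply: contra_eqN h => /eqP ->.
by rewrite dot0l eq_sym oner_eq0.
Qed.

(** The lines not orthogonal to [e] are those of [e + v] with [v] orthogonal to [e]; [T] is [F] in
    this affine chart, the factor making the [e']-component equal to 1. [locked] keeps [T] from
    unfolding. *)
Let T := locked (fun v => (dot (F (e + v)) e')^-1 *: F (e + v) - e').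
Let TE v : T v = (dot (F (e + v)) e')^-1 *: F (e + v) - e'.
Proof. by rewrite /T -lock. Qed.

Let FT_neq0 v : dot v e = 0 -> dot (F (e + v)) e' != 0.
Proof.
move=> ve; apply/eqP => h; have := ev_e ve.
by have /orth_e[_ -> //] := ev_neq0 ve => /esym/eqP; rewrite oner_eq0.
Qed.

Let FT v : dot v e = 0 -> F (e + v) = dot (F (e + v)) e' *: (e' + T v).
Proof. by move=> ve; rewrite TE [e' + _]addrC subrK scalerA divff ?FT_neq0 // scale1r. Qed.

Let Te v : dot v e = 0 -> dot (T v) e' = 0.
Proof. by move=> ve; rewrite TE dotBl dotZl mulVf ?FT_neq0 // e'e' subrr. Qed.

Let T0 : T 0 = 0.
Proof.
rewrite TE addr0 Fe dotZl e'e' mulr1 scalerA mulVf // scale1r subrr //.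
Qed.

Let T_m1 v w : dot v e = 0 -> dot w e = 0 ->
  dot v w = - 1 <-> dot (T v) (T w) = - 1.
Proof.
move=> ve we.
have [h1 h2] := F_orth (ev_neq0 ve) (ev_neq0 we).
have E : dot (e + v) (e + w) = 1 + dot v w.
  by rewrite !dot_simp ee ve (dot_sym0 we) add0r addr0.
have [Tv Tw] := (Te ve, Te we).
have E' : dot (e' + T v) (e' + T w) = 1 + dot (T v) (T w).
  by rewrite dotDl !(dotDr _ e') e'e' Tv (dot_sym0 Tw) add0r addr0.
rewrite E (FT ve) (FT we) dotZl dotZr E' in h1 h2.
split=> h.
  move: h1; rewrite h subrr => /(_ erefl)/eqP.
  rewrite !mulf_eq0 conjC_eq0 !(negPf (FT_neq0 _)) //= addr_eq0 => /eqP E1.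
  by rewrite -[LHS]opprK -E1.
move: h2; rewrite h subrr !mulr0 => /(_ erefl)/eqP; rewrite addr_eq0 => /eqP E1.
by rewrite -[LHS]opprK -E1.
Qed.

Let T_orthF v u : dot v e = 0 -> dot u e = 0 -> u != 0 ->
  dot v u = 0 <-> dot (T v) (F u) = 0.
Proof.
move=> ve ue u0; have [h1 h2] := F_orth (ev_neq0 ve) u0.
have E : dot (e + v) u = dot v u by rewrite dotDl (dot_sym0 ue) add0r.
have Fue : dot e' (F u) = 0 by apply/dot_sym0/orth_e.
rewrite E (FT ve) dotZl dotDl Fue add0r in h1 h2.
split=> h; last by apply: h2; rewrite h mulr0.
by move/eqP: (h1 h); rewrite mulf_eq0 (negPf (FT_neq0 _)) // => /eqP.
Qed.

Let TF v : dot v e = 0 -> v != 0 -> exists2 a, a != 0 & T v = a *: F v.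
Proof.
move=> ve v0.
have Tvv : dot (T v) (F v) != 0.
  apply/eqP => /(T_orthF ve ve v0)/eqP; rewrite dot_eq0.
  exact/negP.
have [u a u0 a0 vu [b E]|a E] := colin (z := T v) v0 _; last first.
  by exists a => //; apply: contraNneq Tvv => a0; rewrite E a0 scale0r dot0l.
apply/(T_orthF ve _ u0) => //; apply/orth_e => //.
have := congr1 (dot ^~ e') E; rewrite dotZl dotBl Te // dotZl.
have [/(_ ve) -> _] := orth_e v0.
by rewrite mulr0 subrr => /eqP; rewrite mulf_eq0 (negPf a0) => /eqP.
Qed.

Let T_neq0 v : dot v e = 0 -> v != 0 -> T v != 0.
Proof.
move=> ve v0; have [a a0 ->] := TF ve v0.
by rewrite scaler_eq0 negb_or a0 F_neq0.
Qed.

Let T_orth v w : dot v e = 0 -> dot w e = 0 ->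
  dot v w = 0 <-> dot (T v) (T w) = 0.
Proof.
move=> ve we; have [->|w0] := eqVneq w 0; first by rewrite T0 !dot0r.
have [a a0 ->] := TF we w0; have [h1 h2] := T_orthF ve we w0.
split=> [/h1 h|/eqP]; first by rewrite dotZr h mulr0.
by rewrite dotZr mulf_eq0 conjC_eq0 (negPf a0) => /eqP.
Qed.

Let T_o v w : dot v e = 0 -> dot w e = 0 -> dot v w = 0 -> dot (T v) (T w) = 0.
Proof. by move=> ve we; case: (T_orth ve we). Qed.
Let T_oV v w : dot v e = 0 -> dot w e = 0 -> dot (T v) (T w) = 0 -> dot v w = 0.
Proof. by move=> ve we; case: (T_orth ve we). Qed.
Let T_1 v w : dot v e = 0 -> dot w e = 0 -> dot v w = - 1 -> dot (T v) (T w) = - 1.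
Proof. by move=> ve we; case: (T_m1 ve we). Qed.
Let T_1V v w : dot v e = 0 -> dot w e = 0 -> dot (T v) (T w) = - 1 -> dot v w = - 1.
Proof. by move=> ve we; case: (T_m1 ve we). Qed.

Let T_surj v' : dot v' e' = 0 -> exists2 v, dot v e = 0 & T v = v'.
Proof.
move=> v'e; have E : dot (e' + v') e' = 1 by rewrite dotDl e'e' v'e addr0.
have [|x [a [x0 a0 xE]]] := @F_surj (e' + v').
  by apply: contra_eqN E => /eqP ->; rewrite dot0l eq_sym oner_eq0.
have d0 : dot x e != 0.
  apply/eqP => /(orth_e x0) h; move/eqP: E.
  by rewrite xE dotZl h mulr0 eq_sym oner_eq0.
pose v := (dot x e)^-1 *: x - e.
have ve : dot v e = 0 by rewrite dotBl dotZl mulVf // ee subrr.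
exists v => //; have evE : e + v = (dot x e)^-1 *: x by rewrite addrC subrK.
have [b b0 Fev] := FZ (invr_neq0 d0) x0.
have FxE : F (e + v) = (b / a) *: (e' + v').
  by rewrite evE Fev xE scalerA divfK.
have ba0 : b / a != 0 by rewrite mulf_neq0 ?invr_eq0.
by rewrite TE FxE dotZl E mulr1 scalerA mulVf // scale1r addrC addKr.
Qed.

Let VZ a v : dot v e = 0 -> dot (a *: v) e = 0.
Proof. by move=> ve; rewrite dotZl ve mulr0. Qed.
Let VD v w : dot v e = 0 -> dot w e = 0 -> dot (v + w) e = 0.
Proof. by move=> ve we; rewrite dotDl ve we addr0. Qed.

(* The orthogonality relation determines [T (v + w)] through its products
   with the vectors [u] such that [dot v u = - 1] and [dot w u = 0]. *)
Let T_test v w : dot v e = 0 -> dot w e = 0 -> v != 0 -> dot v w = 0 ->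
  dot (T (v + w)) (T v) = dot (T v) (T v) /\
  forall q, dot q e' = 0 -> dot q (T v) = 0 -> dot q (T w) = 0 ->
    dot (T (v + w)) q = 0.
Proof.
move=> ve we v0 vw; set s := T (v + w).
have Tvw : dot (T v) (T w) = 0 by apply: T_o.
have N0 : dot (T v) (T v) != 0 by rewrite dot_eq0 T_neq0.
set N := dot (T v) (T v) in N0 *.
have Nc : conjC N = N by rewrite /N -dotC.
(* The preimage [u] of [q - N^-1 *: T v] has product 0 with [w] and [- 1] with [v], hence [- 1] with
   [v + w]. The case [q = 0] gives the product with [T v], and then the general case the product
   with [q]. *)
have key q : dot q e' = 0 -> dot q (T v) = 0 -> dot q (T w) = 0 ->
    dot s (q - N^-1 *: T v) = - 1.
  move=> qe qv qw; have [|u ue uE] := @T_surj (q - N^-1 *: T v).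
    by rewrite dotBl dotZl qe Te // mulr0 subrr.
  have wu : dot w u = 0.
    by apply: T_oV => //; apply/dot_sym0; rewrite uE dotBl dotZl qw Tvw mulr0 subrr.
  have vu : dot v u = - 1.
    apply: T_1V => //; rewrite uE dotBr dotZr (dot_sym0 qv) -/N fmorphV /= Nc.
    by rewrite mulVf // add0r.
  by rewrite -uE; apply: T_1 => //; [exact: VD|rewrite dotDl vu wu addr0].
have sv : dot s (T v) = N.
  have := key 0 (dot0l _ _) (dot0l _ _) (dot0l _ _).
  rewrite sub0r dotNr dotZr fmorphV /= Nc => /oppr_inj.
  by move/(canRL (mulKf (invr_neq0 N0))); rewrite invrK mulr1.
split=> // q qe qv qw; have := key q qe qv qw.
by rewrite dotBr dotZr sv fmorphV /= Nc mulVf // => /(canRL (subrK _)); rewrite addNr.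
Qed.

(** The difference of the two sides is orthogonal to [T v] and [T w], hence by [T_test] to
    [T (v + w)], hence to itself. *)
Let T_addo v w : dot v e = 0 -> dot w e = 0 -> dot v w = 0 ->
  T (v + w) = T v + T w.
Proof.
move=> ve we vw.
have [->|v0] := eqVneq v 0; first by rewrite T0 !add0r.
have [->|w0] := eqVneq w 0; first by rewrite T0 !addr0.
have Tvw : dot (T v) (T w) = 0 by apply: T_o.
have [sv vq] := T_test ve we v0 vw.
have [sw _] := T_test we ve w0 (dot_sym0 vw); rewrite addrC in sw.
apply/eqP; rewrite -subr_eq0; set q := _ - _; apply/eqP.
have qv : dot q (T v) = 0.
  by rewrite /q dotBl (dotDl _ (T v)) sv (dot_sym0 Tvw) addr0 subrr.
have qw : dot q (T w) = 0.
  by rewrite /q dotBl (dotDl _ (T v)) sw Tvw add0r subrr.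
have qe : dot q e' = 0.
  by rewrite /q dotBl (dotDl _ (T v)) !Te ?addr0 ?subrr //; apply: VD.
apply: (@dotxx0 _ _ dot); rewrite {1}/q dotBl (dotDl _ (T v)) vq //.
by rewrite (dot_sym0 qv) (dot_sym0 qw) addr0 subrr.
Qed.

Hypothesis room3 : forall x y, exists u, [/\ u != 0, dot u x = 0 & dot u y = 0].

Let Tcol l v : dot v e = 0 -> v != 0 -> exists b, T (l *: v) = b *: T v.
Proof.
move=> ve v0; have [->|l0] := eqVneq l 0; first by exists 0; rewrite !scale0r T0.
have lv0 : l *: v != 0 by rewrite scaler_eq0 negb_or l0.
have [a a0 Ta] := TF ve v0; have [b b0 Tb] := TF (VZ l ve) lv0.
have [c c0 Fc] := FZ l0 v0.
by exists (b * c / a); rewrite Tb Fc Ta !scalerA divfK.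
Qed.

(** [T] is additive on orthogonal pairs, so comparing coefficients in [T (l *: (v + w))] shows that
    [l] has the same factor on [v] and on [w]. *)
Let Tcol_orth l b v w : dot v e = 0 -> dot w e = 0 -> v != 0 -> w != 0 ->
  dot v w = 0 -> T (l *: v) = b *: T v -> T (l *: w) = b *: T w.
Proof.
move=> ve we v0 w0 vw Tlv.
have vw0 : v + w != 0.
  apply/eqP => /(congr1 (dot v)); rewrite dotDr vw addr0 dot0r => /eqP.
  by rewrite dot_eq0 (negPf v0).
have [c Tlw] := Tcol l we w0; have [d] := Tcol l (VD ve we) vw0.
have Tvw : dot (T v) (T w) = 0 by apply: T_o.
rewrite scalerDr (T_addo (VZ l ve) (VZ l we)); last by rewrite dotZl dotZr vw !mulr0.
rewrite (T_addo ve we vw) Tlv Tlw scalerDr => E.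
have Nv : dot (T v) (T v) != 0 by rewrite dot_eq0 T_neq0.
have Nw : dot (T w) (T w) != 0 by rewrite dot_eq0 T_neq0.
have := congr1 (dot ^~ (T v)) E; have := congr1 (dot ^~ (T w)) E.
rewrite !dotDl !dotZl Tvw (dot_sym0 Tvw) !mulr0 !add0r !addr0.
by move=> /(mulIf Nw) -> /(mulIf Nv) ->.
Qed.

Variable v0 : H.
Hypotheses (v00 : v0 != 0) (v0e : dot v0 e = 0).

Let N0 : dot (T v0) (T v0) != 0. Proof. by rewrite dot_eq0 T_neq0. Qed.

Definition tau l := dot (T (l *: v0)) (T v0) / dot (T v0) (T v0).

Let TZ0 l : T (l *: v0) = tau l *: T v0.
Proof.
by have [b E] := Tcol l v0e v00; rewrite /tau E dotZl mulfK.
Qed.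

Let split_v0 v : dot v e = 0 -> exists b w,
  [/\ v = b *: v0 + w, dot w e = 0 & dot v0 w = 0].
Proof.
move=> ve; exists (dot v v0 / dot v0 v0), (v - (dot v v0 / dot v0 v0) *: v0).
rewrite addrC subrK; split=> //; last exact: dot_proj.
by rewrite dotBl dotZl ve v0e mulr0 subrr.
Qed.

Let TZ l v : dot v e = 0 -> T (l *: v) = tau l *: T v.
Proof.
move=> ve; have [b [w [-> we v0w]]] := split_v0 ve.
have Tb : T (l *: (b *: v0)) = tau l *: T (b *: v0).
  have [->|b0] := eqVneq b 0; first by rewrite scale0r scaler0 T0 scaler0.
  (* [b *: v0] is not orthogonal to [v0]; the factor travels from [v0] to an orthogonal [t] and back
     to the line of [v0]. *)
  have [t [t0 te tv]] := room3 e v0.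
  have bv0 : b *: v0 != 0 by rewrite scaler_eq0 negb_or b0.
  apply: (@Tcol_orth _ _ t) => //; first exact: VZ.
    by rewrite dotZr tv mulr0.
  apply: (@Tcol_orth _ _ v0) => //; exact: dot_sym0.
have [w0|w0] := eqVneq w 0; first by rewrite w0 addr0.
have Tw : T (l *: w) = tau l *: T w by apply: (@Tcol_orth _ _ v0).
have bw : dot (b *: v0) w = 0 by rewrite dotZl v0w mulr0.
rewrite scalerDr (T_addo (VZ l (VZ b v0e)) (VZ l we)).
  by rewrite Tb Tw -scalerDr -(T_addo (VZ b v0e) we bw).
by rewrite dotZl dotZr bw !mulr0.
Qed.

Let scale_inj a b : a *: T v0 = b *: T v0 -> a = b.
Proof. by move/(congr1 (dot ^~ (T v0))); rewrite !dotZl => /(mulIf N0). Qed.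

Lemma tau1 : tau 1 = 1. Proof. by rewrite /tau scale1r divff. Qed.

Lemma tauM : {morph tau : a b / a * b}.
Proof.
move=> a b; apply: scale_inj.
by rewrite -[LHS]TZ0 -scalerA (TZ a (VZ b v0e)) TZ0 scalerA.
Qed.

(* [a v0 + w] and [b v0 + d w] are orthogonal for a suitable [d]. *)
Lemma tauD : {morph tau : a b / a + b}.
Proof.
move=> a b; have [w [w0 we wv0]] := room3 e v0.
have v0w := dot_sym0 wv0.
have Nw : dot w w != 0 by rewrite dot_eq0.
pose d := - (conjC a * b * dot v0 v0 / dot w w).
have o : dot (a *: v0 + w) (b *: v0 + d *: w) = 0.
  rewrite !dot_simp v0w wv0 !mulr0 add0r addr0 /d rmorphN !rmorphM /= fmorphV /= conjCK -!dotC.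
  by rewrite mulNr divfK // mulrA subrr.
have T2 c1 c2 : T (c1 *: v0 + c2 *: w) = tau c1 *: T v0 + tau c2 *: T w.
  by rewrite T_addo ?VZ // ?TZ // dotZl dotZr v0w !mulr0.
have E : T ((a + b) *: v0 + (1 + d) *: w) = T (a *: v0 + 1 *: w) + T (b *: v0 + d *: w).
  rewrite -T_addo; [by rewrite !scalerDl addrACA| | |by rewrite scale1r];
  by apply: VD; apply: VZ.
have Tvw : dot (T w) (T v0) = 0 by apply: T_o.
have := congr1 (dot ^~ (T v0)) E.
rewrite !T2 !dotDl !dotZl Tvw !mulr0 !addr0 -mulrDl; exact: mulIf.
Qed.

Let T_add v w : dot v e = 0 -> dot w e = 0 -> T (v + w) = T v + T w.
Proof.
move=> ve we; have [->|vn0] := eqVneq v 0; first by rewrite T0 !add0r.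
have [c [u [vu ue ->]]] : exists c u, [/\ dot v u = 0, dot u e = 0 & w = c *: v + u].
  exists (dot w v / dot v v), (w - (dot w v / dot v v) *: v).
  split; [exact: dot_proj| |by rewrite addrC subrK].
  by rewrite dotBl dotZl we ve mulr0 subrr.
have cvu b : dot (b *: v) u = 0 by rewrite dotZl vu mulr0.
have -> : v + (c *: v + u) = (1 + c) *: v + u by rewrite scalerDl scale1r addrA.
rewrite (T_addo (VZ _ ve) ue (cvu _)) (T_addo (VZ _ ve) ue (cvu _)) !(TZ _ ve).
by rewrite tauD tau1 scalerDl scale1r addrA.
Qed.

Let tau0 : tau 0 = 0. Proof. by rewrite /tau scale0r T0 dot0l mul0r. Qed.

Let tau_eq0 l : l != 0 -> tau l != 0.
Proof.
move=> l0; apply/eqP => t0; have := tauM l l^-1.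
by rewrite divff // tau1 t0 mul0r => /eqP; rewrite oner_eq0.
Qed.

Lemma tauN1 : tau (- 1) = - 1.
Proof.
by apply/eqP; rewrite -addr_eq0 -[X in _ + X]tau1 -tauD addNr tau0.
Qed.

(** Scaling [v] by [- c^-1] makes the product [- 1], the one nonzero value that [T] is known to
    preserve. *)
Let T_dot v w : dot v e = 0 -> dot w e = 0 -> dot (T v) (T w) = tau (dot v w).
Proof.
move=> ve we; have [c0|c0] := eqVneq (dot v w) 0.
  rewrite c0 tau0; exact: T_o.
set c := dot v w in c0 *.
have : dot (T ((- c^-1) *: v)) (T w) = - 1.
  by apply: T_1 => //; [exact: VZ|rewrite dotZl mulNr mulVf].
rewrite TZ // dotZl => /(congr1 ( *%R (tau c))); rewrite mulrA -tauM mulrN divff //.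
by rewrite tauN1 mulrN1 mulN1r => /oppr_inj.
Qed.

(** Every scalar is a product with [v0], and exchanging the arguments of the form conjugates it. *)
Lemma tau_conj l : tau (conjC l) = conjC (tau l).
Proof.
pose x := (l / dot v0 v0) *: v0.
have vv : dot v0 v0 != 0 by rewrite dot_eq0.
have xE : dot x v0 = l by rewrite dotZl divfK.
by rewrite -xE -dotC -!T_dot ?VZ // -dotC.
Qed.

Lemma tau_surj l : exists a, tau a = l.
Proof.
have [|v ve Tv] := @T_surj (l *: T v0); first by rewrite dotZl Te // mulr0.
have [b [w [vE we v0w]]] := split_v0 ve; exists b; move: Tv.
have Tvw : dot (T w) (T v0) = 0 by apply: T_o => //; apply: dot_sym0.
rewrite vE T_addo ?VZ ?TZ //; last by rewrite dotZl v0w mulr0.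
move/(congr1 (dot ^~ (T v0))); rewrite dotDl !dotZl Tvw addr0; exact: mulIf.
Qed.

(** The extension of [T] by [e] going to [e']; as [tau 1 = 1], it sends [e + v] to [e' + T v]. *)
Let U x := tau (dot x e) *: e' + T (x - dot x e *: e).

Let projV x : dot (x - dot x e *: e) e = 0.
Proof. by rewrite dotBl dotZl ee mulr1 subrr. Qed.

Let UD x y : U (x + y) = U x + U y.
Proof.
rewrite /U addrACA -scalerDl -tauD -dotDl -T_add ?projV //.
by rewrite addrACA -opprD -scalerDl -dotDl.
Qed.

Let UZ a x : U (a *: x) = tau a *: U x.
Proof.
by rewrite /U dotZl tauM scalerDr scalerA -TZ ?projV // scalerBr scalerA.
Qed.

Let U_dot x y : dot (U x) (U y) = tau (dot x y).
Proof.
rewrite /U; set a := dot x e; set b := dot y e.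
set x1 := x - _; set y1 := y - _.
have [xe ye] := (projV x, projV y); rewrite -/a -/b -/x1 -/y1 in xe ye.
rewrite (dotDl _ (_ *: e')) !(dotDr _ (_ *: e')) !dotZl !dotZr e'e'.
rewrite (Te xe) (dot_sym0 (Te ye)) !mulr0 addr0 add0r mulr1 T_dot //.
rewrite -tau_conj -tauM -tauD; congr tau.
have E u w : dot u e = 0 -> dot w e = 0 ->
    dot (u + a *: e) (w + b *: e) = a * conjC b + dot u w.
  move=> ue we; rewrite !dot_simp ee ue (dot_sym0 we) !mulr0 mulr1 addr0 add0r.
  by rewrite addrC.
by rewrite -(E x1 y1) // !subrK.
Qed.

Let U_inj : injective U.
Proof.
move=> x y E; apply/eqP; rewrite -subr_eq0; apply/eqP.
have /eqP : U (x - y) = 0.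
  by apply: (addIr (U y)); rewrite -UD subrK add0r.
rewrite -(dot_eq0 dot) U_dot => h; apply: (@dotxx0 _ _ dot).
by apply: contraTeq h => /tau_eq0.
Qed.

Let U_surj y : exists x, U x = y.
Proof.
have ye : dot (y - dot y e' *: e') e' = 0 by rewrite dotBl dotZl e'e' mulr1 subrr.
have [a aE] := tau_surj (dot y e'); have [v ve vE] := T_surj ye.
exists (a *: e + v); rewrite /U dotDl dotZl ee ve addr0 mulr1 aE.
by rewrite [_ + v]addrC addrK vE addrC subrK.
Qed.

Lemma uhlhorn_semiunitary : exists2 U', semiunitary tau U' &
  forall x, x != 0 -> exists2 b, b != 0 & U' x = b *: F x.
Proof.
exists U.
  split=> //; have [V VU] := choice U_surj.
  by exists V => // x; apply: U_inj; rewrite VU.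
move=> x x0; set a := dot x e.
have xE : x = a *: e + (x - a *: e) by rewrite addrC subrK.
have [a0|a0] := eqVneq a 0.
  have xe : dot x e = 0 by [].
  have [b b0 Tx] := TF xe x0; exists b => //.
  by rewrite /U xe scale0r subr0 Tx tau0 scale0r add0r.
pose v := a^-1 *: (x - a *: e).
have ve : dot v e = 0 by apply/VZ/projV.
have avE : a *: v = x - a *: e by rewrite /v scalerA divff // scale1r.
have xE' : x = a *: (e + v) by rewrite scalerDr avE -xE.
have [b b0 Fx] := FZ a0 (ev_neq0 ve).
have bq0 : b * dot (F (e + v)) e' != 0 by rewrite mulf_neq0 // FT_neq0.
have {}Fx : F x = (b * dot (F (e + v)) e') *: (e' + T v).
  by rewrite {1}xE' Fx {1}(FT ve) scalerA.
exists (tau a / (b * dot (F (e + v)) e')).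
  by rewrite mulf_neq0 ?invr_eq0 ?tau_eq0.
by rewrite /U -/a -avE (TZ _ ve) -scalerDr Fx scalerA divfK.
Qed.

End Uhlhorn.

(** * From lines back to subspaces *)

Section Automorphisms.
Context {C : numClosedFieldType} {H : lmodType C}.
Variable dot : {dot H for conjC}.
Implicit Types (a b c : C) (u v w x y z : H) (X Y Z : set H) (n m j : nat).
Local Notation "X <+> x" := (addl X x) (at level 50, left associativity).
Local Notation nperp := (nperp dot).
Local Notation perp := (perp dot).
Local Notation odim := (odim dot).
Local Notation oadj := (oadj dot).
Local Notation room := (room dot).
Local Notation auto := (auto dot).
Local Notation fstar := (@fstar C H).
Local Notation orth3 := (orth3 dot).
Local Notation all_star := (all_star dot).
Local Notation semiunitary := (semiunitary dot).

Definition conj_auto (s : C -> C) := [/\ {morph s : a b / a + b},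
  {morph s : a b / a * b}, s 1 = 1, forall l, s (conjC l) = conjC (s l) &
  forall l, exists a, s a = l].

Lemma nperp_set0 x : nperp [set 0] x <-> x != 0.
Proof. by split=> [[]//|x0]; split=> // _ ->; apply: dot0l. Qed.

Lemma odim_line x : x != 0 -> odim 1 ([set 0] <+> x).
Proof. by move=> x0; apply: odimS; [exact: odim0|apply/nperp_set0]. Qed.

Lemma odim1_line X : odim 1 X -> exists2 x, x != 0 & X = [set 0] <+> x.
Proof.
by move=> /odimS_inv[Z [x [/odim0_inv -> px ->]]]; exists x => //; apply: nperp_n0 px.
Qed.

Lemma oadj_line x y : x != 0 -> y != 0 ->
  oadj 0 ([set 0] <+> x) ([set 0] <+> y) <-> dot x y = 0.
Proof.
move=> /nperp_set0 px /nperp_set0 py; split=> [/(oadj_star (odim0 dot) px py)|xy].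
  exact: (nperp_dot (odim_sub (odim0 dot))).
by apply: oadj_intro => //; [exact: odim0|apply: nperp_addl].
Qed.

Lemma semiunitary0 s U : semiunitary s U -> U 0 = 0.
Proof. by case=> _ UD _ _; apply: (addIr (U 0)); rewrite -UD !add0r. Qed.

Lemma image_addl s U Z x : conj_auto s -> semiunitary s U ->
  U @` (Z <+> x) = (U @` Z) <+> U x.
Proof.
move=> [_ _ _ _ ss] [_ UD UZ _]; apply/seteqP; split.
  move=> _ [_ [z [a [Zz ->]]] <-]; exists (U z), (s a).
  by rewrite UD UZ; split=> //; exists z.
move=> _ [_ [l [[z Zz <-] ->]]]; have [a <-] := ss l.
by exists (z + a *: x); [exists z, a|rewrite UD UZ].
Qed.

Lemma conj_auto0 s : conj_auto s -> s 0 = 0.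
Proof. by case=> sD _ _ _ _; apply: (addIr (s 0)); rewrite -sD !add0r. Qed.

Lemma nperp_image s U X x : conj_auto s -> semiunitary s U -> nperp X x -> nperp (U @` X) (U x).
Proof.
move=> cs su px; have [bU _ _ UU] := su; split.
  apply: contraNneq (nperp_n0 px) => Ux; apply/eqP/(bij_inj bU).
  by rewrite Ux (semiunitary0 su).
by move=> _ [w Xw <-]; rewrite UU (nperp_orth px Xw) (conj_auto0 cs).
Qed.

Lemma odim_image s U n X : conj_auto s -> semiunitary s U -> odim n X -> odim n (U @` X).
Proof.
move=> cs su; elim=> [|{}n Z x oZ IH px].
  rewrite image_set1 (semiunitary0 su); exact: odim0.
by rewrite (image_addl _ _ cs su); apply: odimS => //; apply: (nperp_image cs su).
Qed.

Lemma perp_image s U X : conj_auto s -> semiunitary s U -> perp (U @` X) = U @` (perp X).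
Proof.
move=> cs su; have [[V UV VU] _ _ UU] := su; apply/seteqP; split.
  move=> y oy; exists (V y) => // x Xx; apply: contrapT => /eqP xy.
  have : dot (U x) y != 0.
    rewrite -[y]VU UU; apply/eqP => sd; move/eqP: xy; case.
    have [_ sM s1 _ _] := cs.
    have [//|d0] := eqVneq (dot x (V y)) 0.
    have := sM (dot x (V y)) (dot x (V y))^-1.
    by rewrite divff // s1 sd mul0r => /eqP; rewrite oner_eq0.
  by case/eqP; apply: oy; exists x.
by move=> _ [y oy <-] _ [x Xx <-]; rewrite UU oy // (conj_auto0 cs).
Qed.

Lemma auto_lines f g : auto 0 0 f g -> room 3 ->
  exists s U, [/\ conj_auto s, semiunitary s U & forall X, odim 1 X -> f X = U @` X].
Proof.
move=> fg r.
have fo X : odim 1 X -> odim 1 (f X) by case: fg => -[h _ _] _; apply: h.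
have go X : odim 1 X -> odim 1 (g X) by case: fg => _ [h _ _]; apply: h.
have gfK X : odim 1 X -> g (f X) = X by case: fg => -[_ h _] _; apply: h.
have fgK X : odim 1 X -> f (g X) = X by case: fg => _ [_ h _]; apply: h.
have /choice[F FP] : forall x, exists y, x != 0 ->
    y != 0 /\ f ([set 0] <+> x) = [set 0] <+> y.
  move=> x; have [->|x0] := eqVneq x 0; first by exists 0.
  by have [y y0 E] := odim1_line (fo _ (odim_line x0)); exists y.
have F0 x : x != 0 -> F x != 0 by move=> /FP[].
have fF x : x != 0 -> f ([set 0] <+> x) = [set 0] <+> F x by move=> /FP[].
have Fo x y : x != 0 -> y != 0 -> dot x y = 0 <-> dot (F x) (F y) = 0.
  move=> x0 y0; split.
    move=> /(oadj_line x0 y0)/(auto_oadj fg); rewrite !fF //.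
    by move/(oadj_line (F0 _ x0) (F0 _ y0)).
  move=> /(oadj_line (F0 _ x0) (F0 _ y0))/(auto_oadj (auto_sym fg)).
  by rewrite -!fF // !gfK; [move/(oadj_line x0 y0)|exact: odim_line|exact: odim_line].
have Fs y : y != 0 -> exists x a, [/\ x != 0, a != 0 & y = a *: F x].
  move=> y0; have [x x0 gE] := odim1_line (go _ (odim_line y0)).
  have E : [set 0] <+> y = [set 0] <+> F x by rewrite -fF // -gE fgK //; apply: odim_line.
  have : ([set 0] <+> y) y by apply/addl_id/(odim_sub (odim0 dot)).
  rewrite E => -[_ [a [-> yE]]]; rewrite add0r in yE.
  exists x, a; split=> //; apply: contraNneq y0 => a0.
  by rewrite yE a0 scale0r.
have r3 x y : exists u, [/\ u != 0, dot u x = 0 & dot u y = 0].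
  have [n1 [Y1 [n1j oY1 _ Y1x]]] := odim_extend x (odim0 dot).
  have [n2 [Y2 [n2j oY2 Y12 Y2y]]] := odim_extend y oY1.
  have [|u pu] := r _ _ oY2; first by lia.
  exists u; split; first exact: nperp_n0 pu.
    by apply: nperp_orthl pu _; apply: Y12.
  exact: nperp_orthl pu Y2y.
have [|x px] := r _ _ (odim0 dot); first by [].
have x0 := nperp_n0 px.
have unit_of z : z != 0 -> exists2 c, c != 0 & dot (c *: z) (c *: z) = 1.
  move=> z0; have d0 : dot z z != 0 by rewrite dot_eq0.
  have sd0 : sqrtC (dot z z) != 0 by rewrite sqrtC_eq0.
  exists (sqrtC (dot z z))^-1; first by rewrite invr_eq0.
  have sc : conjC (sqrtC (dot z z)) = sqrtC (dot z z).
    by apply/CrealP/ger0_real; rewrite sqrtC_ge0 dnorm_ge0.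
  rewrite dotZl dotZr fmorphV /= sc mulrA -invfM -expr2 sqrtCK mulVf //.
have [c c0 ee] := unit_of _ x0; set e := c *: x in ee.
have e0 : e != 0 by rewrite scaler_eq0 negb_or c0.
have [c' c'0 e'e'] := unit_of _ (F0 _ e0); set e' := c' *: F e in e'e'.
have Fe : F e = c'^-1 *: e' by rewrite scalerA mulVf // scale1r.
have [v0 [v00 v0e _]] := r3 e e.
have ci := invr_neq0 c'0.
have [U su UF] := uhlhorn_semiunitary F0 Fo Fs ee e'e' ci Fe r3 v00 v0e.
set s := tau _ _ _ _ _ in su.
have cs : conj_auto s.
  split.
  - exact: (tauD F0 Fo Fs ee e'e' ci Fe r3 v00 v0e).
  - exact: (tauM F0 Fo Fs ee e'e' ci Fe r3 v00 v0e).
  - exact: (tau1 F0 Fo Fs ee e'e' ci Fe v00 v0e).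
  - exact: (tau_conj F0 Fo Fs ee e'e' ci Fe r3 v00 v0e).
  - exact: (tau_surj F0 Fo Fs ee e'e' ci Fe r3 v00 v0e).
exists s, U; split=> // _ /odim1_line[z z0 ->].
rewrite (image_addl _ _ cs su) image_set1 (semiunitary0 su) fF //.
by have [b b0 ->] := UF _ z0; rewrite addl_scale.
Qed.

Lemma odim_hyperplane n X x : odim n.+2 X -> X x -> exists Z, [/\ odim n.+1 Z, Z `<=` X & Z x].
Proof.
move=> oX Xx; have [x0|x0] := eqVneq x 0.
  have [Z [z [oZ pz ->]]] := odimS_inv oX; exists Z; split=> //; first exact: addlW.
  by rewrite x0; apply: (sub0 (odim_sub oZ)).
have oh := odim_hyp oX Xx x0; have [Y [y [oY py hE]]] := odimS_inv oh.
have [Xy xy] : hyp dot X x y by rewrite hE; apply/addl_id/(odim_sub oY).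
exists (hyp dot X y); split; first exact: odim_hyp oX Xy (nperp_n0 py).
  by move=> w [].
by split=> //; apply: dot_sym0.
Qed.

(** [X] has dimension at least 2, so it is the union of its hyperplanes [Z], whose images under [U]
    lie in [f X]; equality follows from equal dimensions. *)
Lemma image_up s U j k f g (f' : set H -> set H) : conj_auto s -> semiunitary s U ->
    auto j.+1 k f g -> j.+1 = k ->
    (forall Z X, odim j.+1 Z -> odim j.+2 X -> Z `<=` X -> f' Z `<=` f X) ->
    (forall Z, odim j.+1 Z -> f' Z = U @` Z) ->
  forall X, odim j.+2 X -> f X = U @` X.
Proof.
move=> cs su [[fo _ _] _] jk ff f'U X oX; symmetry.
apply: (odim_sameE (odim_image cs su oX)); first by rewrite jk; apply: fo.
move=> _ [x Xx <-]; have [Z [oZ ZX Zx]] := odim_hyperplane oX Xx.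
by apply: (ff Z) => //; rewrite f'U //; exists x.
Qed.

Lemma large_all_star j f g : auto j j f g -> room (j + j + 3) -> room (j + 4) ->
  all_star f j.
Proof.
move=> fg r r4 Z x v y oZ o.
have [|none] := fstar_all_or_none fg oZ r4; first exact.
have [x' [v' [y' [o' s']]]] := star_exists fg oZ r.
by case: (none _ _ _ o').
Qed.

Lemma large_image j f g : auto j j f g -> room (j + j + 3) ->
  exists s U, [/\ conj_auto s, semiunitary s U & forall X, odim j.+1 X -> f X = U @` X].
Proof.
elim: j f g => [|j IHj] f g fg r; first exact: auto_lines fg r.
have r4 : room (j.+1 + 4) by apply: roomS r; lia.
have r5 : room (j + 5) by apply: roomS r; lia.
have r' : room (j + j + 3) by apply: roomS r; lia.
have sf := large_all_star fg r r4; have sg := large_all_star (auto_sym fg) r r4.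
have [f' [g' [fg' ff]]] := auto_descend fg r5 r5 sf sg.
have [s [U [cs su f'U]]] := IHj _ _ fg' r'.
by exists s, U; split=> //; apply: (image_up cs su fg erefl ff f'U).
Qed.

Lemma odim_setT_or_room n : room n \/ exists2 m, (m < n)%N & odim m setT.
Proof.
have [|nr] := pselect (room n); [by left|right].
apply: contrapT => h; apply: nr => m X oX mn.
have [XT|XT] := pselect (X = setT).
  by case: h; exists m; rewrite -?XT.
by have [|x [px _]] := nperp_exists oX sub_setT _ XT; last by exists x.
Qed.

Theorem image_neq j f g : auto j j f g -> room 3 -> room j.+2 ->
    ~ odim (j.+1 + j.+1) setT ->
  exists s U, [/\ conj_auto s, semiunitary s U & forall X, odim j.+1 X -> f X = U @` X].
Proof.
move=> fg r3 rj nT.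
have [r|[m mj oT]] := odim_setT_or_room (j + j + 3); first exact: large_image fg r.
have m2 : m <> (j.+1 + j.+1)%N by move=> E; apply: nT; rewrite -E.
have jm : (j.+2 <= m)%N.
  rewrite leqNgt; apply/negP => mlt; have [x px] := rj _ _ oT mlt.
  by have := nperp_n0 px; rewrite (perp_self (X := setT) _ (proj2 px)) // eqxx.
(* Complements have dimension [k.+1 = m - j.+1]. As [m < j.+1 + j.+1], twice this dimension is less
   than [m], so [large_image] applies to the conjugate of [f] by [perp]. *)
pose k := (m - j.+2)%N.
have oT' : odim (j + k + 2) setT by have -> : (j + k + 2 = m)%N by rewrite /k; lia.
have oT'' : odim (k + j + 2) setT by rewrite (addnC k).
have r : room (k + k + 3) by apply: roomS (odim_room oT); rewrite /k; lia.
have h : auto k k ((perp \o f) \o perp) (perp \o (g \o perp)).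
  by apply: auto_comp (auto_perp oT'') _; apply: auto_comp fg (auto_perp oT').
have [s [U [cs su hU]]] := large_image h r.
exists s, U; split=> // X oX.
have oX' : odim k.+1 (perp X).
  have -> : k.+1 = (m - j.+1)%N by rewrite /k; lia.
  exact: odim_perp oT oX.
have fo : odim j.+1 (f X) by case: fg => -[fo _ _] _; apply: fo.
rewrite -(perp_perpE fo); have := hU _ oX'; rewrite /= (perp_perpE oX) => ->.
by rewrite (perp_image _ cs su) (perp_perpE oX).
Qed.

Lemma all_star_connected j f g : auto j.+1 j.+1 f g ->
    odim (j.+1 + j.+1 + 2) setT -> (1 < j.+1)%N ->
  (exists Z x v y, [/\ odim j.+1 Z, orth3 Z x v y & fstar f Z x v y]) -> all_star f j.+1.
Proof.
move=> fg oT j1 [Z [x [v [y [oZ o s]]]]] Z' x' v' y' oZ'.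
have r : room (j.+1 + 4) by apply: roomS (odim_room oT); lia.
have r3 : room (j + 3) by apply: roomS r; lia.
have SZ u1 u2 u3 : orth3 Z u1 u2 u3 -> fstar f Z u1 u2 u3.
  by move=> o'; apply: (fstar_const fg oZ r o).
exact: (oadj_connected
  (P := fun Z => forall u1 u2 u3, orth3 Z u1 u2 u3 -> fstar f Z u1 u2 u3) r3
  (fun Z1 Z2 h => all_star_step fg oT j1 h) oZ oZ' SZ).
Qed.

(** A star triangle with star image is, read backwards, a star triangle with star image under [g];
    [all_star_connected] spreads this from one triangle to all. *)
Lemma all_star_inv j f g : auto j.+1 j.+1 f g ->
    odim (j.+1 + j.+1 + 2) setT -> (1 < j.+1)%N -> all_star f j.+1 -> all_star g j.+1.
Proof.
move=> fg oT j1 sf; have r := odim_room oT.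
apply: (all_star_connected (auto_sym fg) oT j1).
have r4 : room (j.+1 + 4) by apply: roomS r; lia.
have [Z oZ _] := odim_grow (roomS (leq_addr 4 j.+1) r4) (odim0 dot) isT.
have [x [v [y o]]] := orth3_exists oZ r4.
have [XV XY VY] := orth3_oadj oZ o.
have gfK X : odim j.+2 X -> g (f X) = X by case: fg => -[_ h _] _; apply: h.
have := sf _ _ _ _ oZ o; rewrite /fstar.
have [P [a [b [oP pa pb fX fV]]]] := auto_oadj fg XV.
have fXY := auto_oadj fg XY; have fVY := auto_oadj fg VY.
have sP := odim_sub oP.
rewrite fX fV /star (meet_addl sP pa pb) => PY.
rewrite fX in fXY; rewrite fV in fVY.
have [c pc fY] := oadj_inter oP pa fXY PY; rewrite fY in fVY.
have ab := nperp_dot sP pb; have ac := nperp_dot sP pc.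
have bc : dot b c = 0.
  by apply: (nperp_dot sP); apply: (oadj_star oP (nperp_base pb) (nperp_base pc)).
exists P, a, b, c; split=> //.
  by split=> //; split=> //; [apply: nperp_base pb|apply: nperp_base pc].
rewrite -fX -fV -fY !gfK; [|exact: oadj_od (oadj_sym XY)|exact: oadj_od VY|exact: oadj_od XY].
have [[px pv py] [xv xy vy]] := o.
by rewrite (meet_addl (odim_sub oZ) px (nperp_addl pv xv)); apply: addlW.
Qed.

Lemma all_star_image j f g : auto j.+1 j.+1 f g ->
    odim (j.+1 + j.+1 + 2) setT -> (1 < j.+1)%N -> all_star f j.+1 ->
  exists s U, [/\ conj_auto s, semiunitary s U & forall X, odim j.+2 X -> f X = U @` X].
Proof.
move=> fg oT j1 sf; have r := odim_room oT.
have r5 : room (j + 5) by apply: roomS r; lia.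
have r' : room (j + j + 3) by apply: roomS r; lia.
have sg := all_star_inv fg oT j1 sf.
have [f' [g' [fg' ff]]] := auto_descend fg r5 r5 sf sg.
have [s [U [cs su f'U]]] := large_image fg' r'.
by exists s, U; split=> //; apply: (image_up cs su fg erefl ff f'U).
Qed.

Theorem image_eq j f g : auto j.+1 j.+1 f g ->
    odim (j.+1 + j.+1 + 2) setT -> (1 < j.+1)%N ->
  exists s U, [/\ conj_auto s, semiunitary s U &
    (forall X, odim j.+2 X -> f X = U @` X) \/
    (forall X, odim j.+2 X -> f X = perp (U @` X))].
Proof.
move=> fg oT j1.
have [sf|nsf] := pselect (all_star f j.+1).
  by have [s [U [cs su fU]]] := all_star_image fg oT j1 sf; exists s, U; split; auto.
(* By connectedness a single star image would make all images stars. Hence every image is a top, and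
   its complement a star. *)
have sof : all_star (perp \o f) j.+1.
  move=> Z x v y oZ o; have [XV XY VY] := orth3_oadj oZ o.
  apply: (star_perp (auto_oadj fg XV) (auto_oadj fg XY) (auto_oadj fg VY)) => s.
  by apply/nsf/(all_star_connected fg oT j1); exists Z, x, v, y.
have [s [U [cs su fU]]] := all_star_image (auto_perp_comp oT fg) oT j1 sof.
exists s, U; split=> //; right=> X oX.
have fo : odim j.+2 (f X) by case: fg => -[fo _ _] _; apply: fo.
by rewrite -fU //= (perp_perpE fo).
Qed.

End Automorphisms.

(** * Hilbert spaces *)

Section Bridge.
Context {R : realType} {H : completeNormedModType R[i]}.
Variable dot : {dot H for conjC}.
Hypothesis dotE : forall x : H, dot x x = `|x| ^+ 2.
Implicit Types (X Y Z B : set H) (n m j : nat) (u v w x y z : H).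
Local Notation "X <+> x" := (addl X x) (at level 50, left associativity).
Local Notation nperp := (nperp dot).
Local Notation perp := (perp dot).
Local Notation odim := (odim dot).
Local Notation oadj := (oadj dot).
Local Notation room := (room dot).

Lemma linear_subspaceE X : linear_subspace X <-> subspace X.
Proof.
split=> [[X0 XL]|[X0 XL]]; split; first exact: set_mem.
- by move=> a x y Xx Xy; apply: set_mem; apply: XL; apply: mem_set.
- exact: mem_set.
- by move=> a x y /set_mem Xx /set_mem Xy; apply: mem_set; apply: XL.
Qed.

Lemma sub_linspan B : subspace (linspan B).
Proof.
split=> [X [/linear_subspaceE[]]//|a x y Bx By X [sX BX]].
by case/linear_subspaceE: (sX) => _; apply; [apply: Bx|apply: By].
Qed.

Lemma linspan_gen B : B `<=` linspan B.
Proof. by move=> x Bx X [_]; apply. Qed.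

Lemma linspan_least B X : subspace X -> B `<=` X -> linspan B `<=` X.
Proof. by move=> /linear_subspaceE sX BX x; apply. Qed.

Lemma linspanS B B' : B `<=` B' -> linspan B `<=` linspan B'.
Proof.
move=> BB'; apply: linspan_least; first exact: sub_linspan.
by move=> x /BB' /linspan_gen.
Qed.

Lemma linspan0 : linspan set0 = [set (0 : H)].
Proof.
apply/seteqP; split; last by move=> _ ->; apply: sub0 (sub_linspan _).
by apply: linspan_least => //; apply: odim_sub (odim0 dot).
Qed.

Lemma linspan_addl B x : linspan (B `|` [set x]) = linspan B <+> x.
Proof.
have sB := sub_linspan B; apply/seteqP; split.
  apply: linspan_least; first exact: sub_addl.
  by move=> y [/linspan_gen By|->]; [apply: addlW|apply: addl_id].
apply: addl_least; first exact: sub_linspan.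
  by apply: linspanS => y By; left.
by apply: linspan_gen; right.
Qed.

Lemma linspan_range n (e : 'I_n -> H) :
  linspan (range e) = [set w | exists c : 'I_n -> R[i], w = \sum_i c i *: e i].
Proof.
apply/seteqP; split; last first.
  move=> _ [c ->]; have sE := sub_linspan (range e).
  apply: (big_ind (linspan (range e))); [exact: sub0|exact: subD|].
  by move=> i _; apply: (subZ sE); apply: linspan_gen; exists i.
apply: linspan_least.
  split; first by exists (fun=> 0); rewrite big1 // => i _; rewrite scale0r.
  move=> a _ _ [c ->] [d ->]; exists (fun i => a * c i + d i).
  rewrite scaler_sumr -big_split; apply: eq_bigr => i _ /=.
  by rewrite scalerDl scalerA.
move=> _ [i _ <-]; exists (fun l : 'I_n => (l == i)%:R).
rewrite (bigD1 i) //= eqxx scale1r big1 ?addr0 // => l /negPf li.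
by rewrite li scale0r.
Qed.

Lemma range_recl n (e : 'I_n.+1 -> H) :
  range e = range (e \o lift ord0) `|` [set e ord0].
Proof.
apply/seteqP; split=> [_ [i _ <-]|_ [[i _ <-]|->]]; last 2 first.
- by exists (lift ord0 i).
- by exists ord0.
by case: (unliftP ord0 i) => [j ->|->]; [left; exists j|right].
Qed.

(** Gram-Schmidt: [e ord0] is replaced by its component orthogonal to the span of the others, which
    is nonzero by independence. *)
Lemma lin_indep_odim n (e : 'I_n -> H) : lin_indep e -> odim n (linspan (range e)).
Proof.
elim: n e => [|n IHn] e ie.
  have -> : range e = set0 by apply/seteqP; split=> // y [[]].
  rewrite linspan0; exact: odim0.
pose e1 := e \o lift ord0.
have ie1 : lin_indep e1.
  move=> c c0 i; pose d i := oapp c 0 (unlift ord0 i).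
  have := ie d _ (lift ord0 i); rewrite /d liftK; apply.
  rewrite big_ord_recl unlift_none scale0r add0r -[RHS]c0.
  by apply: eq_bigr => l _; rewrite liftK.
have oZ := IHn _ ie1; set Z := linspan _ in oZ.
have sZ := odim_sub oZ.
have [p Zp op] := odim_projE (e ord0) oZ.
have -> : linspan (range e) = Z <+> (e ord0 - p).
  rewrite range_recl linspan_addl -/Z.
  apply/seteqP; split; apply: addl_least; try exact: addlW; try exact: sub_addl.
    by exists p, 1; rewrite scale1r addrC subrK.
  by apply: (subB (sub_addl _ sZ)); [apply: addl_id|apply: addlW].
apply: odimS oZ _; split=> //; apply/negP => /eqP/(canRL (subrK _)).
rewrite add0r => e0p; move: Zp; rewrite -e0p /Z linspan_range => -[c e0E].
have := ie (fun i => oapp (fun i => - c i) 1 (unlift ord0 i)) _ ord0.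
rewrite unlift_none /= => h; suff : (1 : R[i]) = 0 by move/eqP; rewrite oner_eq0.
apply: h.
rewrite big_ord_recl unlift_none /= scale1r e0E -big_split big1 // => i _ /=.
by rewrite liftK /= scaleNr addrN.
Qed.

Lemma odim_lin_indep n X : odim n X -> exists2 e : 'I_n -> H, lin_indep e &
  X = linspan (range e).
Proof.
elim=> [|{}n Z x oZ [e ie ZE] px].
  exists (fun=> 0); first by move=> c _ [].
  have -> : range (fun _ : 'I_0 => 0 : H) = set0 by apply/seteqP; split=> // y [[]].
  by rewrite linspan0.
pose d i := oapp e x (unlift ord0 i).
have dl : d \o lift ord0 = e by apply/funext => i; rewrite /d /= liftK.
have d0 : d ord0 = x by rewrite /d unlift_none.
exists d; last by rewrite range_recl dl d0 linspan_addl -ZE.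
move=> c; rewrite big_ord_recl d0.
under eq_bigr => i _ do rewrite -[d (lift ord0 i)]/((d \o lift ord0) i) dl.
move=> c0.
have c00 : c ord0 = 0.
  have o : dot (\sum_i c (lift ord0 i) *: e i) x = 0.
    by apply: (nperp_orth px); rewrite ZE linspan_range; exists (c \o lift ord0).
  have := congr1 (dot ^~ x) c0; rewrite dotDl dotZl dot0l o addr0.
  by move/eqP; rewrite mulf_eq0 (negPf (dot_neq0 _ (nperp_n0 px))) orbF => /eqP.
move: c0; rewrite c00 scale0r add0r => /(ie (c \o lift ord0)) ce i.
by case: (unliftP ord0 i) => [l ->|-> //]; apply: ce.
Qed.

Lemma has_dimE n X : has_dim X n <-> odim n X.
Proof.
split=> [[e ie ->]|/odim_lin_indep[e ie ->]]; first exact: lin_indep_odim.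
by exists e.
Qed.

Lemma grassmannE n X : grassmann n X <-> odim n X.
Proof.
split=> [[_ /has_dimE]//|oX].
by split; [apply/linear_subspaceE/(odim_sub oX)|apply/has_dimE].
Qed.

Lemma dim_ge_room n : dim_ge [set: H] n -> room n.
Proof.
move=> [e ie _] m X oX mn; have [XT|XT] := pselect (X = setT).
  have := odim_le (lin_indep_odim ie) oX; rewrite XT => /(_ (@subsetT _ _)).
  by rewrite leqNgt mn.
by have [|x [px _]] := nperp_exists oX (@sub_setT _ H) _ XT; last by exists x.
Qed.

Lemma cauchy_schwarz x y : `|dot x y| <= `|x| * `|y|.
Proof.
have [->|y0] := eqVneq y 0; first by rewrite dot0r !normr0 mulr0.
rewrite -(@ler_pXn2r _ 2) ?nnegrE ?mulr_ge0 // exprMn -!dotE.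
have yy : 0 < dot y y by rewrite dnorm_gt0.
pose c := dot x y / dot y y.
have : 0 <= dot (x - c *: y) (x - c *: y) by exact: dnorm_ge0.
have yo : dot (x - c *: y) y = 0 by apply/dot_sym0/dot_proj.
rewrite dotBr dotZr yo mulr0 subr0 dotBl dotZl [dot y x]dotC subr_ge0.
by rewrite /c mulrAC -normCK ler_pdivrMr.
Qed.

Lemma closure_orth B x y : (forall b, B b -> dot x b = 0) -> closure B y -> dot x y = 0.
Proof.
move=> Bx By; apply: contrapT => /eqP xy.
have x0 : x != 0 by apply: contraNneq xy => ->; rewrite dot0l.
have nx : 0 < `|x| by rewrite normr_gt0.
have e0 : 0 < `|dot x y| / `|x| by rewrite divr_gt0 // normr_gt0.
have [b [Bb]] := By _ (nbhsx_ballx y _ e0).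
rewrite -ball_normE /= => yb.
have := cauchy_schwarz x (y - b); rewrite dotBr (Bx _ Bb) subr0 => h.
have h' : `|x| * `|y - b| < `|dot x y| by rewrite mulrC -ltr_pdivlMr.
by have := le_lt_trans h h'; rewrite ltxx.
Qed.

(** A finite-dimensional subspace is its own double complement, and complements are closed by
    Cauchy-Schwarz. *)
Lemma closure_odim n X : odim n X -> closure X = X.
Proof.
move=> oX; apply/seteqP; split; last exact: subset_closure.
move=> x cx; rewrite -(perp_perpE oX) => y oy.
by apply: closure_orth cx => z Xz; apply/dot_sym0/oy.
Qed.

(** * Orthogonal projection onto the closure of a subspace *)

Section Projection.
Variables (M : set H) (h : H).
Hypothesis sM : subspace M.

(** The form has values in [R[i]]; the squared distance is taken in [R], where infima exist. *)
Let q a : R := complex.Re (dot (h - a) (h - a)).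

Let qE a : (q a)%:C%C = dot (h - a) (h - a).
Proof. exact/RRe_real/ger0_real/dnorm_ge0. Qed.

Let D : set R := [set r | exists2 a, M a & r = q a].

Let D_lb : has_lbound D.
Proof. by exists 0 => _ [a Ma ->]; rewrite -lecR qE dnorm_ge0. Qed.

Let d := inf D.

Let d_le a : M a -> d <= q a.
Proof. by move=> Ma; apply: ge_inf => //; exists a. Qed.

Let near e : set H := [set a | M a /\ q a < d + e ^+ 2].

Let near_neq0 (e : R) : 0 < e -> near e !=set0.
Proof.
move=> e0; have e20 : 0 < e ^+ 2 by rewrite exprn_gt0.
have [|_ [a Ma ->] qa] := inf_adherent e20 (E := D).
  by split=> //; exists (q 0), 0 => //; apply: sub0.
by exists a; split.
Qed.

(** Moving [a] along [b] to the point nearest to [h] lowers [q a] by |<h - a, b>|^2 / <b,b>. This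
    cannot exceed [e ^+ 2], since [q] stays above its infimum. *)
Let near_orth (e : R) a b : 0 < e -> near e a -> M b ->
  `|dot (h - a) b| <= e%:C%C * `|b|.
Proof.
move=> e0 [Ma qa] Mb.
have [->|b0] := eqVneq b 0; first by rewrite dot0r !normr0 mulr0.
have eC : 0 <= e%:C%C by rewrite ler0c ltW.
rewrite -(@ler_pXn2r _ 2) ?nnegrE ?mulr_ge0 // exprMn -dotE.
have bb : 0 < dot b b by rewrite dnorm_gt0.
pose x := h - a; pose c := dot x b / dot b b.
have yo : dot (x - c *: b) b = 0 by apply/dot_sym0/dot_proj.
have pE : dot (x - c *: b) (x - c *: b) = dot x x - `|dot x b| ^+ 2 / dot b b.
  by rewrite dotBr dotZr yo mulr0 subr0 dotBl dotZl [dot b x]dotC /c mulrAC -normCK.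
have Mp : M (a + c *: b) by apply: (subD sM) => //; apply: subZ.
have := d_le Mp; rewrite -lecR qE opprD addrA pE -/x -qE.
rewrite lerBrDl -lerBrDr => h1; rewrite -ler_pdivrMr //.
apply: le_trans h1 _; rewrite -rmorphB -rmorphXn lecR /= lerBlDl; exact: ltW.
Qed.

(** In place of the parallelogram identity, [near_orth] is applied to the vector [a - b] itself,
    which is the difference of [h - b] and [h - a]. *)
Let near_close (e : R) a b : 0 < e -> near e a -> near e b ->
  `|a - b| <= (2 * e)%:C%C.
Proof.
move=> e0 na nb; have [/eqP|ab0] := boolP (a - b == 0).
  by move=> ->; rewrite normr0 ler0c mulr_ge0 // ltW.
have Mab : M (a - b) by case: na nb => ? _ [? _]; apply: subB.
have ha := near_orth e0 na Mab; have hb := near_orth e0 nb Mab.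
have nab : 0 < `|a - b| by rewrite normr_gt0.
rewrite -(ler_pM2r nab) -expr2 -dotE.
have abE : a - b = (h - b) - (h - a) by rewrite opprB [RHS]addrC addrA subrK.
rewrite -[X in X <= _]ger0_norm ?dnorm_ge0 // {1}abE dotBl.
apply: le_trans (ler_normB _ _) _.
by apply: le_trans (lerD hb ha) _; rewrite -mulrDl -rmorphD /= mulr_natl mulr2n.
Qed.

Lemma projection_exists : exists2 m, closure M m & forall b, M b -> dot (h - m) b = 0.
Proof.
pose F := filter_from [set e : R | 0 < e] near.
have nearS (e e' : R) : 0 < e -> e <= e' -> near e `<=` near e'.
  move=> e0 ee' a [Ma qa]; split=> //; apply: lt_le_trans qa _.
  by rewrite lerD2l ler_pXn2r ?nnegrE ?(ltW e0) ?(ltW (lt_le_trans e0 ee')).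
have FF : ProperFilter F.
  apply: filter_from_proper => //; apply: filter_from_filter; first by exists 1 => /=.
  move=> e e' /= e0 e'0; exists (Num.min e e'); first by rewrite /= lt_min e0.
  have m0 : 0 < Num.min e e' by rewrite lt_min e0.
  by move=> a na; split; apply: nearS na => //; rewrite ge_min lexx ?orbT.
have [m Fm] : exists m : H, F --> m.
  apply/cvg_ex; apply: cauchy_cvg; apply: cauchy_exP => eps eps0.
  have epsE : (complex.Re eps)%:C%C = eps by apply/RRe_real/ger0_real/ltW.
  have r0 : 0 < complex.Re eps by rewrite -ltcR epsE.
  have e0 : 0 < complex.Re eps / 3 by rewrite divr_gt0.
  have [a na] := near_neq0 e0; exists a, (complex.Re eps / 3) => // b nb.
  rewrite -ball_normE /= -epsE; apply: le_lt_trans (near_close e0 na nb) _.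
  by rewrite ltcR; lra.
exists m.
  move=> A /Fm [e e0 eA]; have [a na] := near_neq0 e0.
  by exists a; split; [case: na|apply: eA].
move=> b Mb; apply: contrapT => /eqP hb.
have b0 : b != 0 by apply: contraNneq hb => ->; rewrite dot0r.
have nb0 : 0 < `|b| by rewrite normr_gt0.
(* The product has modulus [g] times the norm of [b]; an almost minimal [a] at distance less than
   [g / 2] from [m] makes it strictly smaller. *)
pose g := `|dot (h - m) b| / `|b|.
have g0 : 0 < g by rewrite divr_gt0 // normr_gt0.
have gE : (complex.Re g)%:C%C = g by apply/RRe_real/ger0_real/ltW.
have r0 : 0 < complex.Re g by rewrite -ltcR gE.
have e0 : 0 < complex.Re g / 2 by rewrite divr_gt0.
have h0 : 0 < (complex.Re g / 2)%:C%C by rewrite ltcR.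
have [e e1 eA] := Fm _ (nbhsx_ballx m _ h0).
have me0 : 0 < Num.min e (complex.Re g / 2) by rewrite lt_min e0 e1.
have [a na] := near_neq0 me0.
have am : `|m - a| < (complex.Re g / 2)%:C%C.
  have : near e a by apply: nearS na => //; rewrite ge_min lexx.
  by move/eA; rewrite -ball_normE.
have na' : near (complex.Re g / 2) a by apply: nearS na => //; rewrite ge_min lexx orbT.
have k1 := near_orth e0 na' Mb.
have k2 : `|dot (a - m) b| < (complex.Re g / 2)%:C%C * `|b|.
  by apply: le_lt_trans (cauchy_schwarz _ _) _; rewrite ltr_pM2r // distrC.
have : `|dot (h - m) b| < g * `|b|.
  have -> : h - m = (h - a) + (a - m) by rewrite addrA subrK.
  rewrite dotDl; apply: le_lt_trans (ler_normD _ _) _.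
  apply: lt_le_trans (ler_ltD k1 k2) _.
  by rewrite -mulrDl -rmorphD /= -splitr gE.
by rewrite /g divfK ?gt_eqF // ltxx.
Qed.

End Projection.

End Bridge.

(** * Hilbert bases and ortho-adjacency *)

Section Compatibility.
Context {R : realType} {H : completeNormedModType R[i]}.
Variable dot : {dot H for conjC}.
Hypothesis dotE : forall x : H, dot x x = `|x| ^+ 2.
Implicit Types (X Y Z B : set H) (n m j : nat) (u v w x y z : H).
Local Notation "X <+> x" := (addl X x) (at level 50, left associativity).
Local Notation nperp := (nperp dot).
Local Notation perp := (perp dot).
Local Notation odim := (odim dot).
Local Notation oadj := (oadj dot).
Local Notation orthonormal_set := (@orthonormal_set R H dot).

Lemma orthonormal_setU1 B x : orthonormal_set B -> dot x x = 1 ->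
  (forall b, B b -> dot x b = 0) -> orthonormal_set (B `|` [set x]).
Proof.
move=> oB xx xB u v /set_mem[Bu|->] /set_mem[Bv|->].
- by apply: oB; apply: mem_set.
- rewrite (dot_sym0 (xB _ Bu)); case: eqP => // ux; move: (xB _ Bu).
  by rewrite ux xx => /eqP; rewrite oner_eq0.
- rewrite xB //; case: eqP => // ux; move: (xB _ Bv).
  by rewrite -ux xx => /eqP; rewrite oner_eq0.
- by rewrite eqxx.
Qed.

Lemma unit_scale x : x != 0 -> exists2 c : R[i], c != 0 & dot (c *: x) (c *: x) = 1.
Proof.
move=> x0; have nx : `|x| != 0 by rewrite normr_eq0.
exists `|x|^-1; first by rewrite invr_eq0.
by rewrite dotE normrZ normfV normr_id mulVf // expr1n.
Qed.

Lemma orthonormal_extend B0 : orthonormal_set B0 ->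
  exists2 B, B0 `<=` B & orthonormal_basis dot B.
Proof.
move=> oB0.
(* Zorn's lemma runs over the sets [A] that are orthonormal together with [B0], so that the union of
   the empty chain qualifies. *)
have [F FP tF|A [oA maxA]] := @Zorn_bigcup H (fun A => orthonormal_set (A `|` B0)).
  have pick x y : (\bigcup_(X in F) X `|` B0) x -> (\bigcup_(X in F) X `|` B0) y ->
      exists A, [/\ orthonormal_set (A `|` B0), (A `|` B0) x & (A `|` B0) y].
    move=> [[A FA Ax]|Bx] [[A' FA' Ay]|By].
    - have [AA|AA] := tF _ _ FA FA'.
        by exists A'; split; [exact: FP|left; apply: AA|left].
      by exists A; split; [exact: FP|left|left; apply: AA].
    - by exists A; split; [exact: FP|left|right].
    - by exists A'; split; [exact: FP|right|left].
    - by exists set0; rewrite set0U.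
  move=> x y /set_mem Ux /set_mem Uy; have [A [oA Ax Ay]] := pick _ _ Ux Uy.
  by apply: oA; apply: mem_set.
exists (A `|` B0); first by move=> x Bx; right.
split=> //; apply/seteqP; split=> // h _.
have sM := sub_linspan (A `|` B0).
have [m cm hm] := projection_exists dotE h sM.
have [/eqP hm0|hm0] := boolP (h - m == 0).
  by rewrite -[h](subrK m) hm0 add0r.
have [c c0 cc] := unit_scale hm0.
have nB b : (A `|` B0) b -> dot (c *: (h - m)) b = 0.
  by move=> Bb; rewrite dotZl hm ?mulr0 //; apply: linspan_gen.
case: (maxA (A `|` [set c *: (h - m)])).
  split; first by move=> x Ax; left.
  move=> /(_ _ (or_intror erefl)) Ax; move: cc; rewrite nB; last by left.
  by move/esym/eqP; rewrite oner_eq0.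
by rewrite setUAC; apply: orthonormal_setU1.
Qed.

Lemma odim_orthonormal n X : odim n X -> exists2 B, orthonormal_set B & X = linspan B.
Proof.
elim=> [|{}n Z x oZ [B oB ZE] px].
  by exists set0; [move=> x y /set_mem|rewrite linspan0].
have [c c0 cc] := unit_scale (nperp_n0 px); exists (B `|` [set c *: x]).
  apply: orthonormal_setU1 => // b Bb; rewrite dotZl (nperp_orthl px) ?mulr0 //.
  by rewrite ZE; apply: linspan_gen.
by rewrite linspan_addl -ZE addl_scale.
Qed.

(** In a common Hilbert basis, a basis vector [s] of [X] outside [Y] is orthogonal to [Y], so the
    intersection is the complement of [s] in [X]. Conversely, an orthonormal basis of [Z] together
    with the normalized [x] and [y] extends to a Hilbert basis of [H]. *)
Lemma ortho_adjacentE j X Y : ortho_adjacent dot j.+1 X Y <-> oadj j X Y.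
Proof.
split.
  move=> [[/(grassmannE dot) oX /(grassmannE dot) oY /(grassmannE dot) /= oZ]].
  move=> [B [oB _] [S [T [SB TB XE YE]]]].
  have sX := odim_sub oX; have sY := odim_sub oY.
  have XY : X <> Y.
    by move=> XY; move: oZ; rewrite XY setIid => /(odim_dim oY)/eqP; rewrite eqn_leq ltnn.
  have [s [Ss Ys]] : exists s, S s /\ ~ Y s.
    apply: contrapT => h; apply: XY; apply: (odim_sameE oX oY).
    rewrite XE -(closure_odim dotE oY); apply: closure_subset; apply: linspan_least => // s Ss.
    by apply: contrapT => Ys; apply: h; exists s.
  have Xs : X s by rewrite XE; apply: subset_closure; apply: linspan_gen.
  have Ts : ~ T s.
    by move=> Ts; apply: Ys; rewrite YE; apply: subset_closure; apply: linspan_gen.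
  have sT t : T t -> dot s t = 0.
    move=> Tt; rewrite oB ?mem_set //; [|exact: SB|exact: TB].
    by case: eqP => // st; case: Ts; rewrite st.
  have sYo y : Y y -> dot s y = 0.
    rewrite YE; apply: closure_orth => // b lb.
    suff : perp [set s] b by apply.
    by apply: (linspan_least (sub_perp _ _) _ lb) => t Tt _ ->; apply: sT.
  have s0 : s != 0 by apply/eqP => s0; apply: Ys; rewrite s0; apply: sub0.
  have os := odim_hyp oX Xs s0.
  have ZE : X `&` Y = hyp dot X s.
    by apply: odim_sameE oZ os _ => z [Xz Yz]; split=> //; apply: sYo.
  have XE' : X = (X `&` Y) <+> s by rewrite ZE hyp_addlE.
  have [y py YE'] := odim_complete oZ oY (@subIsetr _ X Y).
  have ps : nperp (X `&` Y) s by rewrite ZE; apply: nperp_hyp.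
  exists (X `&` Y), s, y; split=> //; apply: nperp_addl => //; apply: sYo.
  by rewrite YE'; apply: addl_id; apply: odim_sub oZ.
move=> XY; have oX := oadj_od XY; have oY := oadj_od (oadj_sym XY).
have [Z [x [y [oZ px py XE YE]]]] := XY; have sZ := odim_sub oZ.
have zy := nperp_base py; have xy := nperp_dot sZ py.
split.
  split; first exact/(grassmannE dot).
    exact/(grassmannE dot).
  by apply/(grassmannE dot); rewrite XE YE (meet_addl sZ px py).
have [B oB ZE] := odim_orthonormal oZ.
have [c c0 cc] := unit_scale (nperp_n0 px); have [d d0 dd] := unit_scale (nperp_n0 py).
have Bx : orthonormal_set (B `|` [set c *: x]).
  apply: orthonormal_setU1 => // b Bb; rewrite dotZl (nperp_orthl px) ?mulr0 //.
  by rewrite ZE; apply: linspan_gen.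
have Bxy : orthonormal_set (B `|` [set c *: x] `|` [set d *: y]).
  apply: orthonormal_setU1 => // b [Bb|->].
    by rewrite dotZl (nperp_orthl zy) ?mulr0 // ZE; apply: linspan_gen.
  by rewrite dotZl dotZr (dot_sym0 xy) !mulr0.
have [B' BB' bB'] := orthonormal_extend Bxy; exists B' => //.
exists (B `|` [set c *: x]), (B `|` [set d *: y]); split.
- by move=> b Bb; apply: BB'; left.
- by move=> b [Bb|Bb]; apply: BB'; [left; left|right].
- by rewrite linspan_addl -ZE addl_scale // -XE (closure_odim dotE oX).
- by rewrite linspan_addl -ZE addl_scale // -YE (closure_odim dotE oY).
Qed.

Lemma automorphism_auto j f : ortho_grassmann_automorphism dot j.+1 f ->
  exists g, auto dot j j f g.
Proof.
move=> [[fG fI fS] fOA].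
have fG' X : odim j.+1 X -> odim j.+1 (f X).
  by move=> /(grassmannE dot) GX; apply/(grassmannE dot)/fG.
have /choice[g gP] : forall Y, exists X, odim j.+1 Y -> odim j.+1 X /\ f X = Y.
  move=> Y; have [oY|] := pselect (odim j.+1 Y); last by exists setT.
  have [X GX XY] := fS Y (proj2 (grassmannE dot _ _) oY).
  by exists X; split=> //; apply/(grassmannE dot).
have gfK X : odim j.+1 X -> g (f X) = X.
  move=> oX; have [oG fE] := gP _ (fG' _ oX).
  by apply: fI => //; apply: mem_set; apply/(grassmannE dot).
have foa X Y : odim j.+1 X -> odim j.+1 Y -> oadj j X Y <-> oadj j (f X) (f Y).
  move=> /(grassmannE dot) GX /(grassmannE dot) GY.
  have [h1 h2] := fOA _ _ GX GY.
  by split=> /ortho_adjacentE; [move/h1|move/h2]; move/ortho_adjacentE.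
exists g; split.
  split=> // X Y XY.
  by apply: (proj1 (foa _ _ (oadj_od XY) (oadj_od (oadj_sym XY)))).
split=> [X /gP[]//|X /gP[]//|X Y XY].
have [oX fX] := gP _ (oadj_od XY); have [oY fY] := gP _ (oadj_od (oadj_sym XY)).
by apply: (proj2 (foa _ _ oX oY)); rewrite fX fY.
Qed.

End Compatibility.

(** * Automorphisms of the complex field commuting with conjugation *)

Section Complex.
Context {R : realType}.
Implicit Types (x y : R) (a : R[i]).

(** A nonnegative number is the product of its square root with the conjugate of that root, so [s]
    preserves the order; it fixes the rationals, which are dense in the reals. *)
Lemma conj_auto_real (s : R[i] -> R[i]) x : conj_auto s -> s x%:C%C = x%:C%C.
Proof.
move=> cs; have [sD sM s1 sJ _] := cs.
have sB : {morph s : a b / a - b}.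
  by move=> a b; apply: (addIr (s b)); rewrite -sD !subrK.
pose f : {rmorphism R[i] -> R[i]} := HB.pack s
  (GRing.isZmodMorphism.Build R[i] R[i] s sB)
  (GRing.isMonoidMorphism.Build R[i] R[i] s (s1, sM)).
have s_ge0 a : 0 <= a -> 0 <= s a.
  move=> a0; have aE : a = sqrtC a * conjC (sqrtC a).
    rewrite -normCK ger0_norm ?sqrtCK ?sqrtC_ge0 //.
  by rewrite aE sM sJ mul_conjC_ge0.
have s_rat q : s (ratr q) = ratr q by exact: (fmorph_rat f).
have ratC (q : rat) : (ratr q : R)%:C%C = ratr q by exact: (fmorph_rat (real_complex R)).
have sxR : s x%:C%C \is Num.real.
  by apply/CrealP; rewrite -sJ; congr s; apply/CrealP/complex_realP; exists x.
have [y sx] : exists y, s x%:C%C = y%:C%C by move/complex_realP: sxR.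
have s_ler (q : rat) : ratr q <= x -> ratr q <= y.
  move=> h; have : 0 <= s (x%:C%C - (ratr q)%:C%C) by rewrite s_ge0 // subr_ge0 lecR.
  by rewrite sB sx ratC s_rat -ratC subr_ge0 lecR.
have s_ger (q : rat) : x <= ratr q -> y <= ratr q.
  move=> h; have : 0 <= s ((ratr q)%:C%C - x%:C%C) by rewrite s_ge0 // subr_ge0 lecR.
  by rewrite sB sx ratC s_rat -ratC subr_ge0 lecR.
rewrite sx; congr (_%:C%C); apply/eqP; rewrite eq_le !leNgt.
apply/andP; split; apply/negP => /rat_in_itvoo[q]; rewrite in_itv /= => /andP[h1 h2].
  by have := s_ger _ (ltW h1); rewrite leNgt h2.
by have := s_ler _ (ltW h2); rewrite leNgt h1.
Qed.

Lemma conj_autoE (s : R[i] -> R[i]) : conj_auto s -> s =1 id \/ s =1 conjC.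
Proof.
move=> cs; have [sD sM s1 _ _] := cs.
have sE a : s a = (complex.Re a)%:C%C + s 'i%C * (complex.Im a)%:C%C.
  by rewrite {1}[a]complexE sD sM !(conj_auto_real _ cs).
have i2 : 'i%C * 'i%C = - 1 :> R[i] by rewrite -expr2 sqr_i.
have : s 'i%C ^+ 2 == 'i%C ^+ 2.
  rewrite !expr2 -sM i2.
  have -> : - 1 = (- 1 : R)%:C%C :> R[i] by rewrite rmorphN rmorph1.
  by rewrite (conj_auto_real _ cs).
rewrite eqf_sqr => /orP[/eqP si|/eqP si]; [left|right] => a.
  by rewrite sE si -complexE.
rewrite sE si [in RHS](complexE a) rmorphD rmorphM /=.
have cr x : conjC (x%:C%C : R[i]) = x%:C%C by apply/CrealP/complex_realP; exists x.
rewrite !cr; congr (_ + _ * _).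
by apply/eqP; rewrite eq_complex /= oppr0 !eqxx.
Qed.

End Complex.

(** * Unitary and anti-unitary operators *)

Section Main.
Context {R : realType} {H : completeNormedModType R[i]}.
Variable dot : {dot H for conjC}.

Lemma semiunitaryE (s : R[i] -> R[i]) U : conj_auto s -> semiunitary dot s U ->
  unitary dot U \/ antiunitary dot U.
Proof.
move=> cs [bU UD UZ UU].
have [sE|sE] := conj_autoE cs; [left|right]; split=> //.
- by move=> a x y; rewrite UD UZ sE.
- by move=> x y; rewrite UU sE.
- by move=> a x y; rewrite UD UZ sE.
- by move=> x y; rewrite UU sE.
Qed.

End Main.

Theorem theorem2 (R : realType) (H : completeNormedModType R[i])
    (dot : {dot H for conjC}) (dotE : forall x : H, dot x x = `|x| ^+ 2)
    (k : nat) (dimH : dim_ge [set: H] 3)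
    (k_gt0 : (0 < k)%N) (k_lt_dimH : dim_ge [set: H] k.+1) :
  (~ has_dim [set: H] (2 * k)%N ->
    forall f : set H -> set H, ortho_grassmann_automorphism dot k f ->
    exists2 U : H -> H, unitary dot U \/ antiunitary dot U &
      forall X, grassmann k X -> f X = U @` X)
  /\
  (has_dim [set: H] (2 * k)%N -> (6 <= 2 * k)%N ->
    forall f : set H -> set H, ortho_grassmann_automorphism dot k f ->
    exists2 U : H -> H, unitary dot U \/ antiunitary dot U &
      (forall X, grassmann k X -> f X = U @` X) \/
      (forall X, grassmann k X -> f X = orthocompl dot (U @` X))).
Proof.
have r3 := dim_ge_room (dot := dot) dimH; have rk := dim_ge_room (dot := dot) k_lt_dimH.
case: k k_gt0 k_lt_dimH rk => // j _ _ rk; split=> [nT f|/(has_dimE dot) oT j3 f].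
  move=> /(automorphism_auto dotE)[g fg].
  have [|s [U [cs su fU]]] := image_neq fg r3 rk.
    by move=> oT; apply: nT; apply/(has_dimE dot); rewrite mul2n -addnn.
  exists U; first exact: semiunitaryE cs su.
  by move=> X /(grassmannE dot); apply: fU.
move=> /(automorphism_auto dotE)[g fg].
(* [k = 1] contradicts [6 <= 2 * k]; below, [k] is [j.+2]. *)
case: j j3 rk oT fg => [|j] j3 rk oT fg; first by [].
have oT' : odim dot (j.+1 + j.+1 + 2) setT.
  by have -> : (j.+1 + j.+1 + 2 = 2 * j.+2)%N by lia.
have [|s [U [cs su fU]]] := image_eq fg oT'; first by lia.
exists U; first exact: semiunitaryE cs su.
by case: fU => fU; [left|right] => X /(grassmannE dot); apply: fU.
Qed.
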